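(* Let $(X_n)_{n\in\mathbb Z}$ be an exchangeable sequence with values in a compact metrizable space $K$, with law $\mu$ on $K^{\mathbb Z}$. Then there exists a probability measure $\eta$ supported on the set $\mathrm{Ber}$ of Bernoulli probability measures on $K^{\mathbb Z}$ such that for every Borel subset $A$ of $K^{\mathbb Z}$, $$\mu(A)=\int_{\mathrm{Ber}}\tilde\pi(A)\,d\eta(\tilde\pi).$$ In particular, for any $k\ge1$ and all Borel sets $A_1,\dots,A_k$ in $K$, $$\mu(X_1\in A_1,\dots,X_k\in A_k)=\int_{\mathrm{Ber}}\pi(A_1)\cdots\pi(A_k)\,d\eta(\tilde\pi).$$
   Context: $X_n$ is the $n$-th coordinate function on $K^{\mathbb Z}$. The sequence is exchangeable if its law $\mu$ satisfies $\mu\circ T_\sigma^{-1}=\mu$ for every permutation $\sigma$ of $\mathbb Z$ with finite support, where $(T_\sigma\omega)_n=\omega_{\sigma(n)}$. For a Borel probability measure $\pi$ on $K$, $\tilde\pi:=\pi^{\otimes\mathbb Z}$ denotes the corresponding product measure on $K^{\mathbb Z}$; these measures $\tilde\pi$ are the Bernoulli measures, and $\mathrm{Ber}$ is the set of all of them. $\eta$ is a Borel probability measure for the weak-star topology on the space of probability measures on $K^{\mathbb Z}$. *)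

(* Defs.v *)
From HB Require Import structures.
From mathcomp Require Import all_boot all_order all_algebra finmap.
From mathcomp Require Import all_classical all_reals all_analysis.

Set Implicit Arguments.
Unset Strict Implicit.
Unset Printing Implicit Defensive.

Import Order.TTheory GRing.Theory Num.Theory.
Import numFieldNormedType.Exports.

Local Open Scope classical_set_scope.
Local Open Scope ring_scope.

Definition metrizable (R : realType) (T : topologicalType) : Prop :=
  exists d : T -> T -> R,
    [/\ forall x y, d x y = 0 <-> x = y,
        forall x y, d x y = d y x,
        forall x y z, d x z <= d x y + d y z
      & forall (x : T) (A : set T),
          nbhs x A <-> exists2 e : R, 0 < e & [set y | d x y < e] `<=` A].

Definition borel (T : ptopologicalType) : measurableType (@open T).-sigma :=
  g_sigma_algebraType (@open T).

(* The pairing of measures with all continuous functions defines the weak-star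
   topology when T is compact, since continuous functions are then bounded. *)
Definition integrals (T : ptopologicalType) (R : realType)
    (nu : probability (borel T) R) : {ptws (continuousType T R) -> R} :=
  fun f => Rintegral nu [set: borel T] f.

Definition weak_star (T : ptopologicalType) (R : realType) : ptopologicalType :=
  initial_topology (@integrals T R).

(* K^Z with the product topology. *)
Definition seqs (K : Type) : Type := {ptws int -> K}.

HB.instance Definition _ (K : topologicalType) := Topological.on (seqs K).
HB.instance Definition _ (K : ptopologicalType) :=
  Pointed.copy (seqs K) (forall _ : int, K).

Definition law (K : ptopologicalType) (R : realType) :=
  probability (borel (seqs K)) R.

Definition coordinate (K : ptopologicalType) (n : int) (w : seqs K) : K := w n.

Definition permute (K : ptopologicalType) (sigma : int -> int) (w : seqs K) :
  seqs K := fun n => w (sigma n).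

Definition exchangeable (K : ptopologicalType) (R : realType) (mu : law K R) :=
  forall sigma : int -> int, bijective sigma ->
    finite_set [set n | sigma n <> n] ->
  forall A : set (borel (seqs K)), measurable A ->
    mu (permute sigma @^-1` A) = mu A.

(* nu is the product measure of copies of pi: such a nu is unique on Borel sets
   when K is second countable. *)
Definition product_law (K : ptopologicalType) (R : realType)
    (pi : probability (borel K) R) (nu : law K R) :=
  forall (F : {fset int}) (A : int -> set (borel K)),
    (forall i, measurable (A i)) ->
    nu [set w | forall i, i \in F -> A i (coordinate i w)] =
      (\prod_(i <- F) pi (A i))%E.

Definition Ber (K : ptopologicalType) (R : realType) : set (law K R) :=
  [set nu | exists pi, product_law pi nu].
Arguments Ber : clear implicits.

(* The measure pi of which nu in Ber is the product; see base_lawE. *)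
Definition base_law (K : ptopologicalType) (R : realType) (nu : law K R) :
  probability (borel K) R := get [set pi | product_law pi nu].

Lemma base_lawE (K : ptopologicalType) (R : realType)
    (pi : probability (borel K) R) (nu : law K R) (A : set (borel K)) :
  product_law pi nu -> measurable A -> base_law nu A = pi A.
Proof.
move=> pinu mA.
have bnu : product_law (base_law nu) nu.
  by rewrite /base_law; apply: (@getPex _ [set p | product_law p nu]); exists pi.
have := bnu [fset 0]%fset (fun=> A) (fun=> mA).
have -> := pinu [fset 0]%fset (fun=> A) (fun=> mA).
by rewrite !big_seq_fset1.
Qed.

(* Main.v *)
(* Limiting frequencies determine the random measure.  For a Borel set A of K,
   exchangeability gives
     E (sum_i a_i 1_A(X_i))^2 = (v - c) sum_i a_i^2   whenever sum_i a_i = 0,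
   so the averages of 1_A(X_i) along any sequence of distinct indices
   converge in L^2 to one and the same limit L_A, almost surely along the
   times 4^k.  Averaging the factors of 1_{A_1}(X_1) ... 1_{A_k}(X_k) over k
   disjoint blocks of indices yields mu(X_1 in A_1, ..., X_k in A_k) = E
   (L_{A_1} ... L_{A_k}).

   To turn the L_A into a measure, take a continuous surjection c from the
   Cantor space onto K (Alexandroff-Hausdorff) and a Borel section of it.  A
   sequence in K^Z is then coded by one sequence of bits; the products of the
   frequencies of cylinders form a consistent family of weights, realized as
   a law on bits by splitting the unit interval.  Its image in K^Z is a
   product measure nu_w for every w, which depends measurably on w and has
   mean mu; eta is the law of nu_w.

   Ber is Borel because it is cut out by countably many equations between
   values nu(U), U a finite intersection of open slabs from a countable base,
   and nu(U) is a limit of integrals of continuous functions. *)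
Require Import Defs.
From HB Require Import structures.
From mathcomp Require Import all_boot all_order all_algebra finmap.
From mathcomp Require Import all_classical all_reals all_analysis.
From mathcomp Require Import measurable_realfun.
From mathcomp Require Import lra ring.

Set Implicit Arguments.
Unset Strict Implicit.
Unset Printing Implicit Defensive.

Import Order.TTheory GRing.Theory Num.Theory.
Import numFieldNormedType.Exports.

Local Open Scope classical_set_scope.
Local Open Scope ring_scope.

(** * Compact metrizable spaces as images of the Cantor space *)

(** The obstacle is that each $L_A$ is fixed only up to a null set depending on $A$, so countable
    additivity in $A$ has no meaning for a single $w$. On bits this disappears: there are countably
    many cylinders, and finitely additive weights on them already come from a measure. Hence
    frequencies are used only for sets of points of $K$ described by finitely many bits of their
    code. One null set takes care of all of them, and on it the sequence is replaced by a constant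
    one, whose frequencies trivially exist; this is why $\nu_w$ is a product measure without
    exception.

    A second obstacle is that $w \mapsto \nu_w$ must be measurable for the Borel sets of the
    weak-star topology, and these include arbitrary unions of basic open sets. Compactness helps: up
    to any error, the integral of a continuous function depends on finitely many cylinder
    probabilities. So near $\nu_w$ the law is controlled by finitely many real parameters out of a
    countable list, and every open set pulls back to a countable union of boxes. *)

Definition compatible_metric (R : realType) (T : topologicalType)
    (d : T -> T -> R) : Prop :=
  [/\ forall x y, d x y = 0 <-> x = y,
      forall x y, d x y = d y x,
      forall x y z, d x z <= d x y + d y z
    & forall (x : T) (A : set T),
        nbhs x A <-> exists2 e : R, 0 < e & [set y | d x y < e] `<=` A].

(** A copy of [K] that carries the pseudometric structure of [d] over the given topology, so that
    [cantor_surj] can be applied to it. *)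
Definition metrized (R : realType) (K : ptopologicalType) (d : K -> K -> R)
  (dK : compatible_metric d) : Type := K.

Section metrized.
Variables (R : realType) (K : ptopologicalType) (d : K -> K -> R).
Hypothesis dK : compatible_metric d.

HB.instance Definition _ := Pointed.copy (metrized dK) K.
HB.instance Definition _ := Nbhs.copy (metrized dK) K.

Let dball (x : metrized dK) (e : R) : set (metrized dK) := [set y | d x y < e].

Let dball_center (x : metrized dK) (e : R) : 0 < e -> dball x e x.
Proof.
by have [d0 _ _ _] := dK; move=> e0; rewrite /dball/=; have /d0 -> := erefl x.
Qed.

Let dball_sym (x y : metrized dK) (e : R) : dball x e y -> dball y e x.
Proof. by have [_ dC _ _] := dK; rewrite /dball/= dC. Qed.

Let dball_triangle (x y z : metrized dK) (e1 e2 : R) :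
  dball x e1 y -> dball y e2 z -> dball x (e1 + e2) z.
Proof.
have [_ _ dD _] := dK; rewrite /dball/= => xy yz.
by rewrite (le_lt_trans (dD _ y _))// ltrD.
Qed.

Let nbhs_dball : @nbhs _ (metrized dK) = nbhs_ (entourage_ dball).
Proof.
have [_ _ _ dN] := dK; apply/funext => x; apply/seteqP; split=> A.
  move=> /dN[e e0 eA]; exists [set xy | dball xy.1 e xy.2]; first by exists e.
  by move=> y /xsectionP/= /eA.
move=> [E [e e0 eE] EA]; apply/dN; exists e => // y xy.
by apply: EA; apply/xsectionP; exact: (eE (x, y)).
Qed.

HB.instance Definition _ := @Nbhs_isPseudoMetric.Build R (metrized dK)
  (entourage_ dball) nbhs_dball dball dball_center dball_sym dball_triangle
  erefl.

Lemma compatible_metric_hausdorff : hausdorff_space K.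
Proof.
have [d0 dC dD dN] := dK; move=> x y xy; apply/d0; apply/eqP.
rewrite eq_le; apply/andP; split; last first.
  (* The triangle inequality around [x], [y], [x] gives [0 <= d x y]. *)
  have := dD x y x; have /d0 -> := erefl x; rewrite (dC y x).
  by move=> h; lra.
rewrite leNgt; apply/negP => dxy0.
have d20 : 0 < d x y / 2 by rewrite divr_gt0.
have [||z []] := xy [set z | d x z < d x y / 2] [set z | d y z < d x y / 2].
- by apply/dN; exists (d x y / 2).
- by apply/dN; exists (d x y / 2).
rewrite /= => h1 h2; have := dD x z y; rewrite (dC z y); lra.
Qed.

 Lemma compact_metrizable_cantor_surj : compact [set: K] ->
  exists2 c : cantor_space -> K, continuous c & forall x, exists b, c b = x.
Proof.
move=> cptK.
have [f fc] := @cantor_surj R (metrized dK) cptK compatible_metric_hausdorff.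
exists f => // x.
have [b _ bx] := @surj _ _ _ _ f x I.
by exists b.
Qed.

End metrized.

(** * Pointwise convergence and countably generated Borel sets *)

Lemma initial_cvg (S : choiceType) (T : topologicalType) (f : S -> T)
    (F : set_system S) (s : S) : Filter F ->
  f @ F --> f s -> F --> (s : initial_topology f).
Proof.
move=> FF cf A [_ [[B oB <-] Bs] BA]; apply: filterS BA _.
by apply: cf; exact: open_nbhs_nbhs.
Qed.

Lemma ptws_cvg (I : Type) (T : topologicalType)
    (F : set_system {ptws I -> T}) (f : {ptws I -> T}) : Filter F ->
  (forall i, g i @[g --> F] --> f i) -> F --> f.
Proof.
move=> FF cF; apply/cvg_sup => i.
exact: (@initial_cvg _ _ (fun g : {ptws I -> T} => g i)).
Qed.

Lemma ptws_continuous (I : Type) (S T : topologicalType)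
    (f : S -> {ptws I -> T}) :
  (forall i, continuous (fun s => f s i)) -> continuous f.
Proof. by move=> cf s; apply: ptws_cvg => i; exact: cf. Qed.

Lemma open_measurable_borel (T : ptopologicalType) (A : set (borel T)) :
  @open T A -> measurable A.
Proof. by move=> oA; exact: sub_sigma_algebra. Qed.

Lemma bigcup_countType_measurable d (T : sigmaRingType d) (I : countType)
    (P : set I) (B : I -> set T) :
  (forall i, measurable (B i)) -> measurable (\bigcup_(i in P) B i).
Proof.
move=> mB; rewrite (_ : \bigcup_(i in P) B i = \bigcup_n
    (if choice.unpickle n is Some i then
       if `[< P i >] then B i else set0
     else set0)).
  apply: bigcupT_measurable => n; case: choice.unpickle => [i|//].
  by case: ifPn => // _; exact: mB.
apply/seteqP; split => x [i].
  move=> Pi Bix; exists (choice.pickle i) => //.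
  by rewrite choice.pickleK asboolT.
move=> _; case: choice.unpickle => [j|//]; case: ifPn => // /asboolP Pj Bjx.
by exists j.
Qed.

Lemma bigcap_countType_measurable d (T : measurableType d) (I : countType)
    (B : I -> set T) :
  (forall i, measurable (B i)) -> measurable (\bigcap_i B i).
Proof.
move=> mB; rewrite -(setCK (\bigcap_i _)) setC_bigcap; apply: measurableC.
by apply: bigcup_countType_measurable => i; exact: measurableC.
Qed.

(** An open set is the union of the members of the base that it contains, and this union is
    countable. *)
Lemma borel_generated (T : ptopologicalType) (I : countType) (B : I -> set T) :
  (forall i, open (B i)) ->
  (forall (V : set T) x, nbhs x V -> exists2 i, B i x & B i `<=` V) ->
  @measurable _ (borel T) = <<s range B >>.
Proof.
move=> oB bB; apply/seteqP; split; last first.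
  apply: smallest_sub; first exact: sigma_algebra_measurable.
  by move=> _ [i _ <-]; exact: open_measurable_borel.
apply: smallest_sub; first exact: smallest_sigma_algebra.
move=> V oV; have -> : V = \bigcup_(i in [set i | B i `<=` V]) B i.
  apply/seteqP; split=> x; last by move=> [i /= iV Bix]; exact: iV.
  by move=> Vx; have [//|i] := bB V x; [exact: open_nbhs_nbhs|exists i].
apply: (@bigcup_countType_measurable _ (g_sigma_algebraType (range B))) => i.
by apply: sub_sigma_algebra; exists i.
Qed.

Lemma continuous_measurable_borel (S T : ptopologicalType) (f : S -> T) :
  continuous f -> measurable_fun [set: borel S] (f : borel S -> borel T).
Proof.
move=> /continuousP cf.
apply: (@measurability _ _ (borel S) (borel T) setT f open) => //.
move=> _ [A oA <-]; rewrite setTI.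
by apply: open_measurable_borel; exact: cf.
Qed.

Lemma measurable_generated d (S : measurableType d) (T : ptopologicalType)
    (I : Type) (B : I -> set T) (f : S -> T) :
  @measurable _ (borel T) = <<s range B >> ->
  (forall i, measurable (f @^-1` (B i))) ->
  measurable_fun [set: S] (f : S -> borel T).
Proof.
move=> TB mf; apply: (@measurability _ _ S (borel T) setT f (range B)) => //.
by move=> _ [_ [i _ <-] <-]; rewrite setTI.
Qed.

Lemma continuous_real_measurable (R : realType) (S : ptopologicalType)
    (f : S -> R) :
  continuous f -> measurable_fun [set: borel S] (f : borel S -> R).
Proof.
move=> /continuousP cf.
apply: (measurability _ (RGenOpens.measurableE R)) => //.
move=> _ [_ [a [b ->] <-]].
by rewrite setTI; apply: open_measurable_borel; apply: cf; exact: interval_open.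
Qed.

(** * Cylinders of the Cantor space *)

Section cantor.
Implicit Types (b : cantor_space) (t : seq bool).

Definition cyl t : set cantor_space := [set b | mkseq b (size t) = t].

Lemma cyl_mkseq b n : cyl (mkseq b n) b.
Proof. by rewrite /cyl/= size_mkseq. Qed.

Lemma cyl_nth b t i : cyl t b -> (i < size t)%N -> b i = nth false t i.
Proof. by move=> <-; rewrite size_mkseq => it; rewrite nth_mkseq. Qed.

Lemma cylP b n b' : cyl (mkseq b n) b' <-> forall i, (i < n)%N -> b' i = b i.
Proof.
split=> [bb' i ni|bb'].
  by rewrite (cyl_nth bb') ?size_mkseq// nth_mkseq.
rewrite /cyl/= size_mkseq; apply: (@eq_from_nth _ false).
  by rewrite !size_mkseq.
by move=> i; rewrite size_mkseq => ni; rewrite !nth_mkseq// bb'.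
Qed.

Lemma nbhs_cantorP b (A : set cantor_space) :
  nbhs b A <-> exists n, cyl (mkseq b n) `<=` A.
Proof.
split; last first.
  move=> [n nA]; apply: filterS nA _.
  elim: n => [|n ih]; first by apply: filterS filterT => b' _.
  have : nbhs b (proj n @^-1` [set b n]).
    by apply: (@proj_continuous _ (fun=> bool) n); exact: discrete_set1.
  apply: filterS2 ih => b' /cylP bb' bn; apply/cylP => i.
  by rewrite ltnS leq_eqVlt => /predU1P[->//|]; exact: bb'.
(* The cylinders around [b] form a filter that converges to [b] in every coordinate, hence in the
   product topology; so each neighbourhood contains one of them. *)
pose F := filter_from [set: nat] (fun n => cyl (mkseq b n)).
have FF : Filter F.
  apply: filter_from_filter; first by exists 0%N.
  move=> m n _ _; exists (maxn m n) => // b' /cylP bb'.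
  by split; apply/cylP => i ik; apply: bb'; rewrite leq_max ik ?orbT.
have Fb : F --> b.
  apply: ptws_cvg => i A' Ab; exists i.+1 => // b' /cylP bb' /=.
  by rewrite bb'//; exact: nbhs_singleton.
by move=> /Fb[n _ nA]; exists n.
Qed.

Lemma open_cyl t : open (cyl t).
Proof.
rewrite openE => b tb; apply/nbhs_cantorP; exists (size t) => b'.
by rewrite tb.
Qed.

Lemma closed_cyl t : closed (cyl t).
Proof.
rewrite -[X in closed X]setCK; apply: open_closedC; rewrite openE => b tb.
apply/nbhs_cantorP; exists (size t) => b'; rewrite /cyl/= size_mkseq => bb'.
by rewrite bb'.
Qed.

Lemma borel_cantorE : @measurable _ (borel cantor_space) = <<s range cyl >>.
Proof.
apply: borel_generated; first exact: open_cyl.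
move=> V b /nbhs_cantorP[n nV]; exists (mkseq b n) => //; exact: cyl_mkseq.
Qed.

End cantor.

(** * A Borel section of the surjection *)

Section section.
Variables (K : ptopologicalType) (c : cantor_space -> K).
Hypotheses (hK : hausdorff_space K) (cc : continuous c)
  (cs : forall x, exists b, c b = x).

(* The lexicographically least point of the fibre of [c] over [x]. *)
Fixpoint least_prefix (x : K) n : seq bool :=
  if n is m.+1 then
    let t := least_prefix x m in
    rcons t (~~ `[< (c @` cyl (rcons t false)) x >])
  else [::].

Definition code (x : K) : cantor_space :=
  fun n => last false (least_prefix x n.+1).

Lemma size_least_prefix x n : size (least_prefix x n) = n.
Proof. by elim: n => //= n ih; rewrite size_rcons ih. Qed.

Lemma mkseq_code x n : mkseq (code x) n = least_prefix x n.
Proof.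
elim: n => // n ih.
by rewrite mkseqS ih /code/= !last_rcons.
Qed.

(** The invariant of the greedy choice: the selected cylinder still meets the fibre, because the bit
    [false] is refused only when that half contains no point of the fibre. *)
Lemma least_prefixP x n : (c @` cyl (least_prefix x n)) x.
Proof.
elim: n => [|n [b nb bx]] /=; first by have [b bx] := cs x; exists b.
case: asboolP => //= hF; exists b => //.
move: nb; rewrite /cyl/= size_rcons size_least_prefix => nb.
rewrite mkseqS nb; case bn : (b n) => //; exfalso; apply: hF.
by exists b => //; rewrite /cyl/= size_rcons size_least_prefix mkseqS nb bn.
Qed.

(** If the value differed from [x], then by continuity [c] would avoid [x] on a whole cylinder
    around [code x]; but each such cylinder meets the fibre over [x]. *)
Lemma codeK x : c (code x) = x.
Proof.
apply: contrapT => /eqP cx.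
have : nbhs (c (code x)) (~` [set x]).
  apply: open_nbhs_nbhs; split; last exact/eqP.
  apply: closed_openC; apply: accessible_closed_set1.
  exact: hausdorff_accessible.
move=> /cc /nbhs_cantorP[n]; rewrite mkseq_code => nx.
by have [b nb bx] := least_prefixP x n; have /= := nx _ nb; rewrite bx.
Qed.

Lemma closed_image_cyl t : closed (c @` cyl t).
Proof.
apply: compact_closed => //; apply: continuous_compact.
  exact: continuous_subspaceT.
apply: (subclosed_compact (@closed_cyl t) cantor_space_compact).
by [].
Qed.

(** Each bit is decided by membership of [x] in the image of a cylinder, which is closed by
    compactness. A prefix is therefore prescribed by finitely many closed sets and complements of
    closed sets. *)
Lemma measurable_code :
  measurable_fun [set: borel K] (code : borel K -> borel cantor_space).
Proof.
apply: (measurable_generated borel_cantorE) => t.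
rewrite (_ : _ @^-1` _ = [set x | least_prefix x (size t) = t]); last first.
  by apply/seteqP; split => x /=; rewrite /cyl/= mkseq_code.
elim/last_ind: t => [|t v ih].
  by rewrite (_ : [set x | _] = setT) //; apply/seteqP; split.
rewrite size_rcons.
have mC : measurable (c @` cyl (rcons t false) : set (borel K)).
  rewrite -(setCK (c @` _)); apply: measurableC; apply: open_measurable_borel.
  by apply: closed_openC; exact: closed_image_cyl.
rewrite (_ : [set x | _] = [set x | least_prefix x (size t) = t] `&`
  if v then ~` (c @` cyl (rcons t false)) else c @` cyl (rcons t false)).
  by apply: measurableI => //; case: v => //; exact: measurableC.
apply/seteqP; split => x /=.
  move=> /rcons_inj[-> vE]; split => //.
  by move: vE; case: asboolP => // + <-.
move=> [->]; case: v => h; first by rewrite asboolF.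
by rewrite asboolT.
Qed.

End section.

(** * Laws on the Cantor space *)

Section tree_measure.
Variables (R : realType) (p : seq bool -> R).
Hypotheses (p_ge0 : forall t, 0 <= p t) (p_nil : p [::] = 1)
  (p_split : forall t, p t = p (rcons t false) + p (rcons t true)).

(** The total weight of the words of the same length that precede [t] lexicographically: at each
    entry [true], the words that branched off to [false] together weigh as much as that sibling. *)
Definition left_end (t : seq bool) : R :=
  \sum_(k < size t) if nth false t k then p (rcons (take k t) false) else 0.

Lemma left_end_rcons t v :
  left_end (rcons t v) = left_end t + (if v then p (rcons t false) else 0).
Proof.
rewrite /left_end size_rcons big_ord_recr/=.
rewrite nth_rcons ltnn eqxx -cats1 take_size_cat//; congr (_ + _).
by apply: eq_bigr => k _ /=; rewrite nth_cat ltn_ord takel_cat// ltnW.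
Qed.

(* The unit interval is split repeatedly: the interval of [t], of length [p t],
   is cut into those of [rcons t false] and [rcons t true], in that order.  A
   uniform point then falls into the interval of [t] with probability [p t]. *)
Fixpoint itv_prefix (u : R) n : seq bool :=
  if n is m.+1 then
    let t := itv_prefix u m in rcons t (left_end (rcons t true) <= u)
  else [::].

Definition itv_branch (u : R) : cantor_space :=
  fun n => last false (itv_prefix u n.+1).

Lemma mkseq_itv_branch u n : mkseq (itv_branch u) n = itv_prefix u n.
Proof.
elim: n => // n ih.
by rewrite mkseqS ih /itv_branch/= !last_rcons.
Qed.

Lemma itv_prefixP (u : R) t : 0 <= u < 1 ->
  itv_prefix u (size t) = t <-> left_end t <= u < left_end t + p t.
Proof.
move=> u01; elim/last_ind: t => [|t v ih].
  by rewrite /left_end big_ord0 add0r p_nil; split.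
rewrite size_rcons/= !left_end_rcons.
have {}ih : itv_prefix u (size t) = t <->
  left_end t <= u < left_end t + (p (rcons t false) + p (rcons t true)).
  by rewrite -p_split.
have p0 := p_ge0 (rcons t false); have p1 := p_ge0 (rcons t true).
split.
  move=> /rcons_inj[/[dup] tE /ih /andP[h1 h2]].
  rewrite tE => vE.
  case: v vE => /= [h3|/negbT]; last rewrite -ltNge => h3.
    by apply/andP; split; lra.
  by apply/andP; split; lra.
move=> /andP[h1 h2]; have tE : itv_prefix u (size t) = t.
  apply/ih; case: v h1 h2 => /= h1 h2; apply/andP; split; lra.
rewrite tE; congr rcons.
case: v h1 h2 => /= h1 h2; first by lra.
by apply/negbTE; rewrite -ltNge; lra.
Qed.

Lemma measurable_itv_branch :
  measurable_fun [set: R] (itv_branch : R -> borel cantor_space).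
Proof.
apply: (measurable_generated borel_cantorE) => t.
rewrite (_ : _ @^-1` _ = [set u | itv_prefix u (size t) = t]); last first.
  by apply/seteqP; split => u /=; rewrite /cyl/= mkseq_itv_branch.
elim/last_ind: t => [|t v ih].
  by rewrite (_ : [set u | _] = setT) //; apply/seteqP; split.
rewrite size_rcons.
rewrite (_ : [set x | _] = [set x | itv_prefix x (size t) = t] `&`
  if v then `[left_end (rcons t true), +oo[%classic
  else ~` `[left_end (rcons t true), +oo[%classic).
  by apply: measurableI => //; case: v => //; exact: measurableC.
apply/seteqP; split => u /=.
  move=> /rcons_inj[-> vE]; split => //.
  by case: v vE => /=; rewrite in_itv/= andbT => // /negP.
move=> [->]; case: v => /=; rewrite in_itv/= andbT => h; congr rcons => //.
exact/negbTE/negP.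
Qed.

Lemma left_end_bounds t : 0 <= left_end t /\ left_end t + p t <= 1.
Proof.
elim/last_ind: t => [|t v [ih1 ih2]].
  by rewrite /left_end big_ord0 add0r p_nil.
rewrite left_end_rcons.
have p0 := p_ge0 (rcons t false); have p1 := p_ge0 (rcons t true).
by move: ih2; rewrite p_split; case: v => h; lra.
Qed.

Lemma tree_measure : exists beta : probability (borel cantor_space) R,
  forall t, beta (cyl t) = (p t)%:E.
Proof.
pose f : measurableTypeR R -> borel cantor_space := itv_branch.
have mf : measurable_fun setT f by exact: measurable_itv_branch.
pose P : probability (measurableTypeR R) R := uniform_prob (@ltr01 R).
exists (distribution P (mfun_Sub (mem_set mf))) => t.
rewrite /distribution/= /pushforward/=.
set A := f @^-1` (cyl t).
have mA : measurable A.
  rewrite -[A]setTI; apply: mf => //.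
  by apply: open_measurable_borel; exact: open_cyl.
have A01 : A `&` `[0, 1[ = `[left_end t, left_end t + p t[%classic.
  have [h1 h2] := left_end_bounds t.
  apply/seteqP; split => u /=;
    rewrite /A/= /f /cyl/= mkseq_itv_branch !in_itv/=.
    by move=> [tu u01]; apply/itv_prefixP.
  move=> /[dup] /andP[h3 h4] h.
  have u01 : 0 <= u < 1 by apply/andP; split; lra.
  by split => //; apply/itv_prefixP.
rewrite /P/= /uniform_prob integral_uniform_pdf.
rewrite (eq_integral (fun=> 1%E)); last first.
  move=> x; rewrite inE/= in_itv/= => -[_ x01].
  by rewrite /uniform_pdf x01 subr0 invr1.
rewrite integral_cst ?mul1e; last exact: measurableI.
(* The uniform law lives on the closed interval, whereas [itv_prefixP] needs [u < 1]; the endpoint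
   is split off as a null set. *)
rewrite (_ : A `&` _ = (A `&` `[0, 1[) `|` (A `&` [set 1])); last first.
  by rewrite -setIUr setUitv1// bnd_simp.
rewrite measureU//; last 3 first.
- exact: measurableI.
- exact: measurableI.
- apply/seteqP; split => // x [[_ x01] [_ x1]].
  by move: x01; rewrite x1/= in_itv/= ltxx andbF.
rewrite A01 [X in (_ + X)%E](_ : _ = 0%E) ?adde0; last first.
  apply/eqP; rewrite eq_le measure_ge0 andbT -(lebesgue_measure_set1 (1 : R)).
  by apply: le_measure; rewrite ?inE//; exact: measurableI.
transitivity
  (lebesgue_measure (`[left_end t, left_end t + p t[%classic : set R)).
  by [].
rewrite lebesgue_measure_itv/= lte_fin ltrDl -EFinB addrAC subrr add0r.
by have := p_ge0 t; rewrite le_eqVlt => /predU1P[<-|->//]; rewrite ltxx.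
Qed.

End tree_measure.

(** * Bit patterns with free positions *)

Lemma nth_Some_cat (o1 o2 : seq (option bool)) v m u :
  nth None (o1 ++ Some v :: o2) m = Some u <->
  nth None (o1 ++ None :: o2) m = Some u \/ m = size o1 /\ u = v.
Proof.
rewrite !nth_cat; case: ltnP => mo1.
  by split; [left|case=> // -[mE _]; rewrite mE ltnn in mo1].
case k : (m - size o1)%N => [|k'] /=.
  have -> : m = size o1 by apply/eqP; rewrite eqn_leq mo1 -subn_eq0 k.
  by split=> [[<-]|[//|[_ ->//]]]; right.
split; first by left.
by case=> // -[mE _]; rewrite mE subnn in k.
Qed.

(** A [None] entry leaves its bit free, and so do all positions beyond the end of [o], through the
    default of [nth]. Such patterns, unlike cylinders, can constrain the bits of one coordinate and
    skip the interleaved bits of the others. *)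
Definition matches (o : seq (option bool)) : set cantor_space :=
  [set b | forall m v, nth None o m = Some v -> b m = v].

Lemma matches_map_Some t : matches (map Some t) = cyl t.
Proof.
apply/seteqP; split => b.
  move=> ob; rewrite /cyl/=; apply: (@eq_from_nth _ false).
    by rewrite size_mkseq.
  move=> i; rewrite size_mkseq => it; rewrite nth_mkseq//.
  by apply: ob; rewrite (nth_map false).
move=> tb m v; have [mt|tm] := ltnP m (size t); last first.
  by rewrite nth_default// size_map.
by rewrite (nth_map false)// => -[<-]; exact: cyl_nth.
Qed.

Lemma matches_setI o1 o2 (v : bool) :
  matches (o1 ++ Some v :: o2) =
  matches (o1 ++ None :: o2) `&` [set b | b (size o1) = v].
Proof.
apply/seteqP; split => b.
  move=> ob; split=> [m u mu|]; first by apply: ob; apply/nth_Some_cat; left.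
  by apply: ob; apply/nth_Some_cat; right.
by move=> [ob bv] m u /nth_Some_cat[|[-> ->]//]; exact: ob.
Qed.

Lemma matches_None o1 o2 :
  matches (o1 ++ None :: o2) =
  matches (o1 ++ Some false :: o2) `|` matches (o1 ++ Some true :: o2).
Proof.
rewrite !matches_setI -setIUr; apply/seteqP; split => b; last by case.
by move=> ob; split => //=; case: (b _); [right|left].
Qed.

Lemma measurable_bit n v :
  measurable ([set b | b n = v] : set (borel cantor_space)).
Proof.
apply: open_measurable_borel; rewrite openE => b bv; apply/nbhs_cantorP.
by exists n.+1 => b' /cylP/(_ n (ltnSn n)) /= ->.
Qed.

Lemma measurable_matches o : measurable (matches o : set (borel cantor_space)).
Proof.
rewrite (_ : matches o = \bigcap_m
    (if nth None o m is Some v then [set b | b m = v] else setT)).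
  by apply: bigcapT_measurable => m; case: nth => // v; exact: measurable_bit.
apply/seteqP; split => b ob.
  by move=> m _; case h : nth => [v|] //=; exact: ob.
by move=> m v h; have := ob m I; rewrite h.
Qed.

(** The empty set is included because incompatible cylinders are disjoint; with it the class is
    closed under intersection. *)
Definition cylinder_or_empty (B : set cantor_space) : Prop :=
  B = set0 \/ exists t, B = cyl t.

Lemma cylinder_setI_closed : setI_closed cylinder_or_empty.
Proof.
have key t t' : (size t <= size t')%N -> cylinder_or_empty (cyl t `&` cyl t').
  move=> tt'; have [tE|tN] := eqVneq (take (size t) t') t.
    right; exists t'; apply/seteqP; split => b; first by case.
    move=> bt'; split => //; rewrite /cyl/= -[in RHS]tE -[in RHS]bt'.
    by rewrite /mkseq -map_take take_iota; move/minn_idPl : tt' => ->.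
  left; apply/seteqP; split => // b [bt bt'].
  move/eqP : tN; apply; rewrite -[RHS]bt -[in LHS]bt'.
  by rewrite /mkseq -map_take take_iota; move/minn_idPl : tt' => ->.
move=> _ _ [->|[t ->]] [->|[t' ->]]; try by left; rewrite ?set0I ?setI0.
by have [|/ltnW] := leqP (size t) (size t'); [|rewrite setIC]; exact: key.
Qed.

Lemma borel_cantor_cylinderE :
  @measurable _ (borel cantor_space) = <<s cylinder_or_empty >>.
Proof.
rewrite borel_cantorE; apply/seteqP; split; apply: smallest_sub.
- exact: smallest_sigma_algebra.
- by move=> _ [t _ <-]; apply: sub_sigma_algebra; right; exists t.
- exact: smallest_sigma_algebra.
- move=> _ [->|[t ->]]; last by apply: sub_sigma_algebra; exists t.
  exact: (@measurable0 _ (g_sigma_algebraType (range cyl))).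
Qed.

Section matches_measure.
Variables (R : realType) (q : seq (option bool) -> R).
Hypotheses (q_ge0 : forall o, 0 <= q o) (q_nil : q [::] = 1)
  (q_rcons : forall o, q (rcons o None) = q o)
  (q_split : forall o1 o2, q (o1 ++ None :: o2) =
     q (o1 ++ Some false :: o2) + q (o1 ++ Some true :: o2)).

Lemma matches_measure : exists beta : probability (borel cantor_space) R,
  forall o, beta (matches o) = (q o)%:E.
Proof.
have [t|//|t|beta betaE] := @tree_measure R (q \o map Some).
- exact: q_ge0.
- by rewrite /= !map_rcons -!cats1 -q_split cats1 q_rcons.
exists beta => o.
(* Generalized over a prefix [t] of specified bits: a free entry is replaced by each of its two
   values, which then joins the prefix. *)
suff H t : beta (matches (map Some t ++ o)) = (q (map Some t ++ o))%:E.
  exact: (H [::]).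
elim: o t => [|[v|] o ih] t; first by rewrite cats0 matches_map_Some betaE.
  by rewrite -cat_rcons -map_rcons ih.
rewrite q_split matches_None measureU; last 3 first.
- exact: measurable_matches.
- exact: measurable_matches.
- by rewrite !matches_setI; apply/seteqP; split => // b [[_ /= ->] []].
rewrite -!cat_rcons -!map_rcons EFinD; congr (_ + _)%E; exact: ih.
Qed.

End matches_measure.

(** * Exchangeability and limiting frequencies *)

Section bounded_expectation.
Context d (T : measurableType d) (R : realType) (P : probability T R).
Implicit Types f g : T -> R.

Definition bounded_mfun f :=
  measurable_fun setT f /\ exists M : R, forall x, `|f x| <= M.

Lemma bounded_mfun_integrable f :
  bounded_mfun f -> P.-integrable setT (EFin \o f).
Proof.
move=> [mf [M fM]]; apply: measurable_bounded_integrable => //.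
  exact: fin_num_fun_lty.
exists M; split; first exact: num_real.
by move=> y My x _ /=; rewrite (le_trans (fM x))// ltW.
Qed.

Lemma bounded_mfun_cst (r : R) : bounded_mfun (fun=> r).
Proof. by split; [exact: measurable_cst|exists `|r|]. Qed.

Lemma bounded_mfun_indic (A : set T) : measurable A -> bounded_mfun \1_A.
Proof.
move=> mA; split; first exact: measurable_indic.
by exists 1 => x; rewrite indicE; case: (_ \in _); rewrite ?normr1 ?normr0.
Qed.

Lemma bounded_mfunD f g :
  bounded_mfun f -> bounded_mfun g -> bounded_mfun (fun x => f x + g x).
Proof.
move=> [mf [M fM]] [mg [N gN]]; split; first exact: measurable_funD.
by exists (M + N) => x; rewrite (le_trans (ler_normD _ _))// lerD.
Qed.

Lemma bounded_mfunM f g :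
  bounded_mfun f -> bounded_mfun g -> bounded_mfun (fun x => f x * g x).
Proof.
move=> [mf [M fM]] [mg [N gN]]; split; first exact: measurable_funM.
by exists (M * N) => x; rewrite normrM ler_pM.
Qed.

Lemma bounded_mfunB f g :
  bounded_mfun f -> bounded_mfun g -> bounded_mfun (fun x => f x - g x).
Proof.
move=> [mf [M fM]] [mg [N gN]]; split; first exact: measurable_funB.
by exists (M + N) => x; rewrite (le_trans (ler_normB _ _))// lerD.
Qed.

Lemma bounded_mfun_norm f : bounded_mfun f -> bounded_mfun (fun x => `|f x|).
Proof.
move=> [mf [M fM]]; split; first exact: measurableT_comp.
by exists M => x; rewrite normr_id.
Qed.

Lemma bounded_mfun_sum (I : Type) (s : seq I) (F : I -> T -> R) :
  (forall i, bounded_mfun (F i)) -> bounded_mfun (fun x => \sum_(i <- s) F i x).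
Proof.
move=> bF; elim: s => [|i s ih].
  by under eq_fun do rewrite big_nil; exact: bounded_mfun_cst.
by under eq_fun do rewrite big_cons; exact: bounded_mfunD.
Qed.

Lemma bounded_mfun_prod (I : Type) (s : seq I) (F : I -> T -> R) :
  (forall i, bounded_mfun (F i)) ->
  bounded_mfun (fun x => \prod_(i <- s) F i x).
Proof.
move=> bF; elim: s => [|i s ih].
  by under eq_fun do rewrite big_nil; exact: bounded_mfun_cst.
by under eq_fun do rewrite big_cons; exact: bounded_mfunM.
Qed.

Lemma Rintegral_sum (I : Type) (s : seq I) (F : I -> T -> R) :
  (forall i, bounded_mfun (F i)) ->
  \int[P]_x (\sum_(i <- s) F i x) = \sum_(i <- s) \int[P]_x F i x.
Proof.
move=> bF; elim: s => [|i s ih].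
  under eq_Rintegral do rewrite big_nil.
  by rewrite Rintegral_cst// mul0r big_nil.
under eq_Rintegral do rewrite big_cons.
rewrite RintegralD ?big_cons ?ih//; apply: bounded_mfun_integrable => //.
exact: bounded_mfun_sum.
Qed.

Lemma Rintegral_scale (r : R) f : bounded_mfun f ->
  \int[P]_x (r * f x) = r * \int[P]_x f x.
Proof. by move=> bf; rewrite RintegralZl//; exact: bounded_mfun_integrable. Qed.

Lemma Rintegral_indic (A : set T) : measurable A ->
  \int[P]_x (\1_A x : R) = fine (P A).
Proof. by move=> mA; rewrite /Rintegral integral_indic// setIT. Qed.

Lemma le_Rintegral_bounded f g : bounded_mfun f -> bounded_mfun g ->
  (forall x, f x <= g x) -> \int[P]_x f x <= \int[P]_x g x.
Proof.
by move=> bf bg fg; apply: le_Rintegral => //; exact: bounded_mfun_integrable.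
Qed.

End bounded_expectation.

(** Induction on [s]: the permutation found for the tail is followed by the transposition of
    [sigma i] and [f i]. This transposition fixes [f k] for [k] in the tail, since [f k] differs
    from [f i] by injectivity of [f] and equals [sigma k], which differs from [sigma i]. *)
Lemma finite_perm_extension (s : seq int) (f : int -> int) :
  uniq s -> {in s &, injective f} ->
  exists sigma : int -> int, [/\ bijective sigma,
    finite_set [set n | sigma n <> n] & {in s, sigma =1 f}].
Proof.
elim: s => [_ _|i s ih /= /andP[iNs us] finj].
  exists id; split => //; first by exists id.
  by rewrite (_ : [set n | _] = set0)//; apply/seteqP; split.
have [|sigma [bs fs sf]] := ih us.
  by move=> x y xs ys; apply: finj; rewrite inE ?xs ?ys orbT.
pose sw (a b x : int) := if x == a then b else if x == b then a else x.
have swK a b : involutive (sw a b).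
  move=> x; rewrite /sw; have [->|xa] := eqVneq x a.
    by rewrite eqxx; have [->|ba] := eqVneq b a; rewrite ?eqxx.
  by have [->|xb] := eqVneq x b; rewrite ?eqxx// (negbTE xa) (negbTE xb).
exists (sw (sigma i) (f i) \o sigma); split.
- by apply: bij_comp => //; exact: inv_bij.
- apply: (@sub_finite_set _ _ ([set n | sigma n <> n] `|`
    ([set sigma i] `|` [set f i]))) => [n /= h|]; last first.
    by rewrite !finite_setU; split.
  have [sn|/eqP sn] := eqVneq (sigma n) n; [right|by left].
  move: h; rewrite sn /sw; case: (n =P sigma i) => [->|_]; first by left.
  by case: (n =P f i) => // ->; right.
- move=> k; rewrite inE => /predU1P[->|ks] /=; first by rewrite /sw eqxx.
  rewrite /sw; case: (sigma k =P sigma i) => [|_].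
    by move=> /(bij_inj bs) ki; rewrite ki (negbTE iNs) in ks.
  rewrite sf//; case: (f k =P f i) => // /finj.
  rewrite !inE eqxx ks orbT => /(_ isT isT) ki.
  by rewrite ki (negbTE iNs) in ks.
Qed.

Section rectangle.
Variable K : ptopologicalType.

Lemma coordinate_continuous n : continuous (@coordinate K n).
Proof. exact: (@proj_continuous _ (fun=> K) n). Qed.

Lemma measurable_coordinate n :
  measurable_fun [set: borel (seqs K)]
    (@coordinate K n : borel (seqs K) -> borel K).
Proof. by apply: continuous_measurable_borel; exact: coordinate_continuous. Qed.

Lemma measurable_coordinate_preimage n (A : set (borel K)) : measurable A ->
  measurable ([set w | A (coordinate n w)] : set (borel (seqs K))).
Proof.
by move=> mA; rewrite -[X in measurable X]setTI; exact: measurable_coordinate.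
Qed.

Lemma measurable_rectangle (J : countType) (s : pred J) (f : J -> int)
    (A : J -> set (borel K)) : (forall i, measurable (A i)) ->
  measurable ([set w | forall i, s i -> A i (coordinate (f i) w)] :
    set (borel (seqs K))).
Proof.
move=> mA; rewrite (_ : [set w | _] = \bigcap_i
    (if s i then [set w | A i (coordinate (f i) w)] else setT)).
  apply: bigcap_countType_measurable => i; case: ifP => // _.
  exact: measurable_coordinate_preimage.
apply/seteqP; split => w.
  by move=> h i _; case: ifP => // si /=; exact: h.
by move=> h i si; have := h i I; rewrite si.
Qed.

Variables (R : realType) (mu : law K R).
Hypothesis mu_exch : exchangeable mu.

(** An injection of finitely many indices agrees on them with a permutation of finite support, so
    only the distinctness of the indices matters. *)
Lemma exchangeable_rectangle (s : seq int) (f : int -> int)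
    (A : int -> set (borel K)) :
  uniq s -> {in s &, injective f} -> (forall i, measurable (A i)) ->
  mu [set w | forall i, i \in s -> A i (coordinate (f i) w)] =
  mu [set w | forall i, i \in s -> A i (coordinate i w)].
Proof.
move=> us fi mA; have [sigma [bs fs sf]] := finite_perm_extension us fi.
rewrite -[RHS](mu_exch bs fs); last first.
  exact: (@measurable_rectangle _ (fun i => i \in s) id A mA).
congr (mu _); apply/seteqP; split => w /= h i si.
  by rewrite /coordinate /permute sf//; exact: h.
by have := h i si; rewrite /coordinate /permute sf.
Qed.

End rectangle.

(** The sum of the absolute increments has finite expectation, hence is finite almost everywhere;
    there the telescoping series converges absolutely. *)
Lemma ae_cvg_of_summable d (T : measurableType d) (R : realType)
    (P : probability T R) (f : nat -> T -> R) (e : nat -> R) :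
  (forall n, bounded_mfun (f n)) ->
  (forall n, \int[P]_x `|f n.+1 x - f n x| <= e n) ->
  (exists M, forall n, \sum_(k < n) e k <= M) ->
  \forall x \ae P, cvgn (fun n => f n x).
Proof.
move=> bf fe [M eM].
have bg n : bounded_mfun (fun x => `|f n.+1 x - f n x|).
  by apply: bounded_mfun_norm; exact: bounded_mfunB.
pose g x := (\sum_(n <oo) (`|f n.+1 x - f n x|)%:E)%E.
have mg : measurable_fun setT g.
  by apply: ge0_emeasurable_sum => // n _; apply/measurable_EFinP; case: (bg n).
have ig : P.-integrable setT g.
  apply/integrableP; split => //.
  under eq_integral do rewrite gee0_abs ?nneseries_ge0//.
  rewrite integral_nneseries//; last first.
    by move=> n; apply/measurable_EFinP; case: (bg n).
  apply: (@le_lt_trans _ _ M%:E); last exact: ltry.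
  apply: lime_le.
    by apply: is_cvg_nneseries => n _ _; exact: integral_ge0.
  apply: nearW => n; rewrite big_mkord.
  apply: le_trans (_ : (\sum_(k < n) e k)%:E <= _)%E.
    rewrite -sumEFin; apply: lee_sum => k _.
    rewrite -[leLHS]fineK ?lee_fin//; first exact: fe.
    by apply: integrable_fin_num => //; exact: bounded_mfun_integrable.
  by rewrite lee_fin.
have := integrable_ae measurableT ig.
apply: filterS => x /(_ Logic.I) gx.
suff : cvgn (series (telescope (f ^~ x))).
  move=> h; rewrite (_ : (fun n => f n x) =
      (fun n => f 0%N x + series (telescope (f ^~ x)) n)); last first.
    by apply/funext => n; rewrite -eq_sum_telescope.
  by apply: is_cvgD => //; exact: is_cvg_cst.
apply: normed_cvg.
apply: nondecreasing_is_cvgn.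
  by apply: nondecreasing_series => n _ _ /=.
exists (fine (g x)) => _ [n _ <-].
rewrite -lee_fin fineK// /series/= -sumEFin.
exact: nneseries_lim_ge.
Qed.

Lemma Rintegral_norm_le_square d (T : measurableType d) (R : realType)
    (P : probability T R) (f : T -> R) (t : R) : bounded_mfun f -> 0 < t ->
  \int[P]_x `|f x| <= (t * \int[P]_x (f x ^+ 2) + t^-1) / 2.
Proof.
(* AM-GM: [`|f x| <= t / 2 * f x ^+ 2 + t^-1 / 2] *)
move=> bf t0; have b2 : bounded_mfun (fun x => f x ^+ 2).
  by under eq_fun do rewrite expr2; exact: bounded_mfunM.
have bt : bounded_mfun (fun x => t / 2 * f x ^+ 2).
  by apply: bounded_mfunM => //; exact: bounded_mfun_cst.
apply: (@le_trans _ _ (\int[P]_x (t / 2 * f x ^+ 2 + t^-1 / 2))).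
  apply: le_Rintegral_bounded.
  - exact: bounded_mfun_norm.
  - by apply: bounded_mfunD => //; exact: bounded_mfun_cst.
  move=> x; rewrite -real_normK ?num_real//.
  have : 0 <= t^-1 / 2 * (t * `|f x| - 1) ^+ 2.
    by rewrite mulr_ge0 ?sqr_ge0// divr_ge0// invr_ge0 ltW.
  rewrite (_ : _ * _ ^+ 2 = t / 2 * `|f x| ^+ 2 + t^-1 / 2 - `|f x|)
    ?subr_ge0//.
  by field; rewrite gt_eqF.
rewrite RintegralD//; last 2 first.
- exact: bounded_mfun_integrable.
- by apply: bounded_mfun_integrable; exact: bounded_mfun_cst.
have -> : \int[P]_x (t^-1 / 2) = t^-1 / 2.
  by rewrite Rintegral_cst//; have /= -> := probability_setT P; rewrite mulr1.
by rewrite Rintegral_scale// mulrDl mulrAC.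
Qed.

Section averages.
Variables (K : ptopologicalType) (R : realType).
Implicit Types (A : set (borel K)) (tau : nat -> int).

Definition visits A n : borel (seqs K) -> R :=
  fun w => \1_[set w' | A (coordinate n w')] w.

Definition average A tau n : borel (seqs K) -> R :=
  fun w => n%:R^-1 * \sum_(i < n) visits A (tau i) w.

Lemma bounded_visits A n : measurable A -> bounded_mfun (visits A n).
Proof.
by move=> mA; apply: bounded_mfun_indic; exact: measurable_coordinate_preimage.
Qed.

Lemma visits_01 A n w : 0 <= visits A n w <= 1.
Proof. by rewrite /visits indicE; case: (_ \in _); rewrite lexx ler01. Qed.

Lemma bounded_average A tau n : measurable A -> bounded_mfun (average A tau n).
Proof.
move=> mA; apply: bounded_mfunM; first exact: bounded_mfun_cst.
by apply: bounded_mfun_sum => i; exact: bounded_visits.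
Qed.

Lemma average_01 A tau n w : 0 <= average A tau n w <= 1.
Proof.
apply/andP; split.
  apply: mulr_ge0; rewrite ?invr_ge0//; apply: sumr_ge0 => i _.
  by have /andP[] := visits_01 A (tau i) w.
have [->|n0] := eqVneq n 0%N; first by rewrite /average big_ord0 mulr0.
rewrite /average ler_pdivrMl ?ltr0n ?lt0n// mulr1.
rewrite -[X in _ <= X%:R]card_ord -sumr_const; apply: ler_sum => i _.
by have /andP[] := visits_01 A (tau i) w.
Qed.

Variables (mu : law K R) (A : set (borel K)).
Hypotheses (mu_exch : exchangeable mu) (mA : measurable A).

(* By exchangeability the mean of a product of two visits takes only two values,
   [v] on the diagonal and [c] off it; as the [a i] sum to [0], only
   [(v - c) * \sum_i a i ^+ 2] survives. *)
Lemma second_moment (I : finType) (tau : I -> int) (a : I -> R) :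
  injective tau -> \sum_i a i = 0 ->
  \int[mu]_w ((\sum_i a i * visits A (tau i) w) ^+ 2) <= \sum_i a i ^+ 2.
Proof.
move=> tauI a0.
pose v := fine (mu [set w | A (coordinate 0 w)]).
pose c := fine (mu [set w | forall i : int, i \in [:: 0; 1] ->
  A (coordinate i w)]).
have mX n := measurable_coordinate_preimage n mA.
have m2 i j : \int[mu]_w (visits A (tau i) w * visits A (tau j) w) =
    if i == j then v else c.
  (* The two visits become one rectangle over the reference indices 0 and 1, sent to [tau i] and
     [tau j]; in this form exchangeability applies. *)
  transitivity (\int[mu]_w (\1_[set w | forall k : int, k \in [:: 0; 1] ->
      A (coordinate (if k == 0 then tau i else tau j) w)] w : R)).
    apply: eq_Rintegral => w _; rewrite /visits -[LHS]/((\1__ \* \1__) w).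
    rewrite -indicI; congr (\1__ w); apply/seteqP; split => w' /=.
      by move=> [h1 h2] k _; case: ifP.
    move=> h; split; first by have := h 0; rewrite inE eqxx; apply.
    by have := h 1; rewrite !inE eqxx orbT; apply.
  rewrite Rintegral_indic; last first.
    exact: (@measurable_rectangle _ int (fun k => k \in [:: 0; 1])
      (fun k => if k == 0 then tau i else tau j) (fun=> A)).
  have [<-|ij] := eqVneq i j.
    congr fine; rewrite [RHS](_ : _ =
      mu [set w | forall k, k \in [:: 0] -> A (coordinate k w)]); last first.
      congr (mu _); apply/seteqP; split => w /=.
        by move=> h k; rewrite inE => /eqP ->.
      by apply; rewrite inE.
    rewrite -(@exchangeable_rectangle _ _ _ mu_exch [:: 0] (fun=> tau i)
      (fun=> A))//.
      congr (mu _); apply/seteqP; split => w /= h k hk.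
        by have := h 0; rewrite inE eqxx; apply.
      by have := h 0; rewrite inE eqxx if_same; apply.
    by move=> x y; rewrite !inE => /eqP -> /eqP ->.
  congr fine; apply: (@exchangeable_rectangle _ _ _ mu_exch [:: 0; 1]
    (fun k => if k == 0 then tau i else tau j) (fun=> A)) => //.
  move=> x y; rewrite !inE => /orP[]/eqP -> /orP[]/eqP -> //=.
    by move=> /tauI ijE; rewrite ijE eqxx in ij.
  by move=> /tauI ijE; rewrite ijE eqxx in ij.
have bv i : bounded_mfun (visits A (tau i)) by exact: bounded_visits.
have bvv i j : bounded_mfun (fun w => visits A (tau i) w * visits A (tau j) w).
  exact: bounded_mfunM.
have bavv i j : bounded_mfun
    (fun w => a i * a j * (visits A (tau i) w * visits A (tau j) w)).
  by apply: bounded_mfunM => //; exact: bounded_mfun_cst.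
rewrite [leLHS](_ : _ =
    \sum_i \sum_j a i * a j * (if i == j then v else c)); last first.
  transitivity (\int[mu]_w (\sum_i \sum_j
      a i * a j * (visits A (tau i) w * visits A (tau j) w))).
    apply: eq_Rintegral => w _; rewrite expr2 big_distrl.
    apply: eq_bigr => i _ /=.
    by rewrite big_distrr/=; apply: eq_bigr => j _; rewrite mulrACA.
  rewrite Rintegral_sum; last by move=> i; exact: bounded_mfun_sum.
  apply: eq_bigr => i _; rewrite Rintegral_sum//; apply: eq_bigr => j _.
  by rewrite Rintegral_scale// m2.
rewrite (_ : \sum_i _ = \sum_i a i ^+ 2 * (v - c)); last first.
  transitivity (\sum_i (\sum_j a i * a j * c + a i ^+ 2 * (v - c))).
    apply: eq_bigr => i _; rewrite (bigD1 i)//= eqxx [in RHS](bigD1 i)//=.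
    rewrite [RHS]addrAC; congr (_ + _); first by ring.
    by apply: eq_bigr => j ji; rewrite eq_sym (negbTE ji).
  rewrite big_split/= [X in X + _]big1 ?add0r// => i _.
  by rewrite -big_distrl -big_distrr/= a0 mulr0 mul0r.
(* What remains is [v - c <= 1], which holds as [v] is a probability and [c] is nonnegative. *)
apply: ler_sum => i _; rewrite ler_piMr ?sqr_ge0//.
rewrite lerBlDr (@le_trans _ _ 1)//; last by rewrite lerDl fine_ge0.
rewrite /v -lee_fin fineK ?probability_le1//; exact: fin_num_measure.
Qed.

End averages.

Lemma Rintegral_bounded_cvg d (T : measurableType d) (R : realType)
    (P : probability T R) (f : nat -> T -> R) (g : T -> R) (M : R) :
  (forall n, measurable_fun setT (f n)) -> measurable_fun setT g ->
  (forall n x, `|f n x| <= M) ->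
  (\forall x \ae P, f n x @[n --> \oo] --> g x) ->
  \int[P]_x f n x @[n --> \oo] --> \int[P]_x g x.
Proof.
move=> mf mg fM fg.
have [|||||ig _ h] := @dominated_convergence _ _ _ P setT measurableT
  (fun n => EFin \o f n) (EFin \o g) (fun=> M%:E).
- by move=> n; exact/measurable_EFinP.
- exact/measurable_EFinP.
- by apply: filterS fg => x fx _; apply: cvg_EFin => //; exact: nearW.
- apply: (@bounded_mfun_integrable _ _ _ P (fun=> M)).
  exact: bounded_mfun_cst.
- by apply: aeW => x n _ /=; rewrite lee_fin.
apply: fine_cvg; rewrite fineK//.
exact: integrable_fin_num.
Qed.

Section frequencies.
Variables (K : ptopologicalType) (R : realType).
Variables (mu : law K R) (mu_exch : exchangeable mu).
Implicit Types (A : set (borel K)) (tau : nat -> int).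

(** [Rintegral_norm_le_square] with [t = 2 ^+ k] plays the part of the Cauchy-Schwarz inequality: it
    gives half of [2 * 2 ^- k + 2 ^- k], which is below the stated bound. *)
Lemma integral_combination_le (I : finType) A (tau : I -> int) (a : I -> R) k :
  measurable A -> injective tau -> \sum_i a i = 0 ->
  \sum_i a i ^+ 2 <= 2 * (4 ^+ k)^-1 ->
  \int[mu]_w `|\sum_i a i * visits R A (tau i) w| <= 2 * 2 ^- k.
Proof.
move=> mA tauI a0 a2.
have bZ : bounded_mfun (fun w => \sum_i a i * visits R A (tau i) w).
  apply: bounded_mfun_sum => i.
  apply: bounded_mfunM; first exact: bounded_mfun_cst.
  exact: bounded_visits.
have t0 : (0 : R) < 2 ^+ k by rewrite exprn_gt0.
apply: (le_trans (Rintegral_norm_le_square mu bZ t0)).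
have h := second_moment mu_exch mA tauI a0.
have : 2 ^+ k * \int[mu]_w ((\sum_i a i * visits R A (tau i) w) ^+ 2) <=
    2 ^+ k * (2 * (4 ^+ k)^-1).
  by rewrite ler_pM2l// (le_trans h).
have -> : 2 ^+ k * (2 * (4 ^+ k)^-1) = 2 * 2 ^- k :> R.
  have -> : (4 : R) = 2 * 2 by ring.
  by rewrite exprMn; field; rewrite gt_eqF.
have : 0 < 2 ^- k :> R by rewrite invr_gt0.
by move: (\int[mu]_w _) => x; lra.
Qed.

(* Sampling the averages at the times [4 ^ k] makes these distances summable, so
   almost sure convergence needs no maximal inequality. *)
Lemma average_step A tau k : measurable A -> injective tau ->
  \int[mu]_w `|average R A tau (4 ^ k.+1) w - average R A tau (4 ^ k) w| <=
  2 * 2 ^- k.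
Proof.
move=> mA tauI; set N := (4 ^ k.+1)%N; set n := (4 ^ k)%N.
have nN : (n <= N)%N by rewrite leq_exp2l.
(* The shorter average is read as a combination of the [N] visits with zero weights at the end. The
   differences [a] then sum to 0 and their squares to [n^-1 - N^-1]. *)
pose b (i : 'I_N) : R := if (i < n)%N then n%:R^-1 else 0.
pose a (i : 'I_N) : R := N%:R^-1 - b i.
have sumb (f : R -> R) : f 0 = 0 -> \sum_i f (b i) = n%:R * f n%:R^-1.
  move=> f0; have <- : \sum_(i < n) f n%:R^-1 = n%:R * f n%:R^-1.
    by rewrite sumr_const card_ord mulr_natl.
  have /= -> := big_ord_widen N (fun=> f n%:R^-1) nN; rewrite [RHS]big_mkcond/=.
  by apply: eq_bigr => i _; rewrite /b; case: ifP.
have N0 : (N%:R : R) != 0 by rewrite pnatr_eq0 -lt0n expn_gt0.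
have n0 : (n%:R : R) != 0 by rewrite pnatr_eq0 -lt0n expn_gt0.
have := @integral_combination_le 'I_N A (tau \o val) a k mA.
under eq_Rintegral.
  move=> w _.
  rewrite (_ : \sum_i _ = average R A tau N w - average R A tau n w);
    last first.
    rewrite /average !mulr_sumr.
    rewrite (big_ord_widen _ (fun i => n%:R^-1 * visits R A (tau i) w) nN).
    rewrite [X in _ - X]big_mkcond/= -sumrB; apply: eq_bigr => i _.
    by rewrite /a /b mulrBl; case: ifP => // _; rewrite mul0r.
  over.
apply.
- by move=> i j /tauI/val_inj.
- rewrite sumrB (sumb id)//= sumr_const card_ord -[_^-1 *+ _]mulr_natl !mulfV//.
  by rewrite subrr.
- rewrite (_ : \sum_i _ = n%:R^-1 - N%:R^-1).
    rewrite /n natrX lerBlDr.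
    have : 0 <= (4 ^+ k)^-1 :> R by rewrite invr_ge0 exprn_ge0.
    have : 0 <= N%:R^-1 :> R by rewrite invr_ge0.
    by lra.
  under eq_bigr do rewrite /a sqrrB.
  rewrite !big_split/= (sumb (fun x => x ^+ 2)) ?expr0n// sumr_const card_ord.
  rewrite sumrN sumrMnl -mulr_sumr (sumb id)//.
  rewrite -[_^-1 ^+ 2 *+ _]mulr_natl. field.
  by rewrite N0 n0.
Qed.

(** Over the disjoint union of the two index sets the difference is again a combination of visits
    with weights of sum 0. The squares of the weights add up to exactly [2 / 4 ^ k], which is the
    origin of the factor 2 in [integral_combination_le]. *)
Lemma average_diff A tau tau' k : measurable A ->
  injective tau -> injective tau' -> (forall i j, tau i != tau' j) ->
  \int[mu]_w `|average R A tau (4 ^ k) w - average R A tau' (4 ^ k) w| <=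
  2 * 2 ^- k.
Proof.
move=> mA tauI tauI' tt'; set n := (4 ^ k)%N.
have n0 : (n%:R : R) != 0 by rewrite pnatr_eq0 -lt0n expn_gt0.
pose f (i : 'I_n + 'I_n) := match i with inl j => tau j | inr j => tau' j end.
pose a (i : 'I_n + 'I_n) : R :=
  match i with inl j => n%:R^-1 | inr j => - n%:R^-1 end.
have := @integral_combination_le ('I_n + 'I_n)%type A f a k mA.
under eq_Rintegral.
  move=> w _.
  rewrite (_ : \sum_i _ = average R A tau n w - average R A tau' n w);
    last first.
    by rewrite big_sumType/= /average -!mulr_sumr mulNr.
  over.
apply.
- move=> [i|i] [j|j] /=; first by move=> /tauI/val_inj ->.
  + by move=> /eqP; rewrite (negbTE (tt' _ _)).
  + by move=> /esym/eqP; rewrite (negbTE (tt' _ _)).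
  + by move=> /tauI'/val_inj ->.
- by rewrite big_sumType/= sumrN subrr.
- rewrite big_sumType/= sqrrN sumr_const card_ord -mulr_natl.
  rewrite -natrX -/n le_eqVlt; apply/orP; left; apply/eqP.
  by field.
Qed.

Lemma average_ae_cvg A tau : measurable A -> injective tau ->
  \forall w \ae mu, cvgn (fun k => average R A tau (4 ^ k) w).
Proof.
move=> mA tauI.
apply: (@ae_cvg_of_summable _ _ _ mu (fun k => average R A tau (4 ^ k))
  (fun k => 2 * 2 ^- k)).
- by move=> k; exact: bounded_average.
- by move=> k; exact: average_step.
- exists 4 => n.
  suff -> : \sum_(k < n) (2 * 2 ^- k) = 4 - 4 * 2 ^- n :> R.
    have : 0 <= 2 ^- n :> R by rewrite invr_ge0 exprn_ge0.
    by lra.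
  elim: n => [|n ih]; first by rewrite big_ord0 expr0 invr1 mulr1 subrr.
  rewrite big_ord_recr/= ih exprS invfM.
  by field; rewrite expf_neq0.
Qed.

(* Disjoint sets of nonnegative indices; the limiting frequencies are computed
   along the negative ones, [Negz]. *)
Definition block (i : int) (m : nat) : int := Posz (choice.pickle (i, m)).

Lemma block_inj i m j n : block i m = block j n -> (i, m) = (j, n).
Proof. by move=> [] /(pcan_inj choice.pickleK). Qed.

(** [limn] has a default value where the averages diverge; [freq] is later evaluated only where they
    converge. *)
Definition freq A : borel (seqs K) -> R :=
  fun w => limn (fun k => average R A Negz (4 ^ k) w).

Lemma integral_prod_visits (s : seq int) (tau : int -> int)
    (B : int -> set (borel K)) :
  uniq s -> {in s &, injective tau} -> (forall i, measurable (B i)) ->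
  \int[mu]_w (\prod_(i <- s) visits R (B i) (tau i) w) =
  fine (mu [set w | forall i, i \in s -> B i (coordinate i w)]).
Proof.
move=> us tauI mB; rewrite -(exchangeable_rectangle mu_exch us tauI mB).
rewrite -Rintegral_indic; last first.
  exact: (@measurable_rectangle _ int (fun k => k \in s) tau B mB).
apply: eq_Rintegral => w _; elim: s {us tauI} => [|i s ih].
  by rewrite big_nil indicE mem_set.
rewrite big_cons ih /visits -[LHS]/((\1__ \* \1__) w) -indicI.
congr (\1__ w); apply/seteqP; split => w' /=.
  by move=> [h1 h2] k; rewrite inE => /predU1P[->//|]; exact: h2.
move=> h; split; first by apply: h; rewrite mem_head.
by move=> k ks; apply: h; rewrite inE ks orbT.
Qed.

(** Induction on [s1], the factors that are still averages. Expanding the average of [i] moves [i]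
    to [s2], with a single time [m] in its own block; by induction all [n] terms have the same
    expectation, whatever times [g] selects. *)
Lemma integral_prod_block_average (s1 s2 : seq int) (g : int -> nat)
    (B : int -> set (borel K)) n :
  (0 < n)%N -> uniq (s1 ++ s2) -> (forall i, measurable (B i)) ->
  \int[mu]_w ((\prod_(i <- s1) average R (B i) (block i) n w) *
              \prod_(i <- s2) visits R (B i) (block i (g i)) w) =
  fine (mu [set w | forall i, i \in s1 ++ s2 -> B i (coordinate i w)]).
Proof.
move=> n0 + mB; elim: s1 s2 g => [|i s1 ih] s2 g us.
  under eq_Rintegral do rewrite big_nil mul1r.
  apply: (integral_prod_visits (tau := fun i => block i (g i))) => //.
  by move=> x y _ _ /block_inj[].
have pE : perm_eq (s1 ++ i :: s2) ((i :: s1) ++ s2).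
  by rewrite -[i :: s2]cat1s perm_catCA.
have us' : uniq (s1 ++ i :: s2) by rewrite (perm_uniq pE).
have is2 : i \notin s2.
  by move: us'; rewrite cat_uniq => /and3P[_ _ /= /andP[]].
pose g' m j := if j == i then m else g j.
pose F m w := n%:R^-1 * ((\prod_(j <- s1) average R (B j) (block j) n w) *
  \prod_(j <- i :: s2) visits R (B j) (block j (g' m j)) w).
transitivity (\int[mu]_w (\sum_(m < n) F m w)).
  apply: eq_Rintegral => w _; rewrite /F -!mulr_sumr big_cons {1}/average.
  rewrite -!mulrA; congr (_ * _); rewrite mulrCA; congr (_ * _).
  rewrite mulr_suml; apply: eq_bigr => m _.
  rewrite big_cons /g' eqxx; congr (_ * _).
  apply: eq_big_seq => j js2; case: eqP => // ji.
  by rewrite -ji js2 in is2.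
have bP m : bounded_mfun (fun w =>
    (\prod_(j <- s1) average R (B j) (block j) n w) *
    \prod_(j <- i :: s2) visits R (B j) (block j (g' m j)) w).
  apply: bounded_mfunM; apply: bounded_mfun_prod => j.
    exact: bounded_average.
  exact: bounded_visits.
rewrite Rintegral_sum; last first.
  by move=> m; apply: bounded_mfunM => //; exact: bounded_mfun_cst.
transitivity (\sum_(m < n) n%:R^-1 * fine (mu [set w | forall k,
    k \in (i :: s1) ++ s2 -> B k (coordinate k w)])).
  apply: eq_bigr => m _; rewrite Rintegral_scale// ih//.
  congr (_ * fine (mu _)); apply/seteqP; split => w /= h k ks.
    by apply: h; rewrite (perm_mem pE).
  by apply: h; rewrite -(perm_mem pE).
rewrite sumr_const card_ord -[_ *+ _]mulr_natl mulrA mulfV ?mul1r//.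
by rewrite pnatr_eq0 -lt0n.
Qed.

Lemma prod_dist_le (I : Type) (s : seq I) (x y : I -> R) :
  (forall i, 0 <= x i <= 1) -> (forall i, 0 <= y i <= 1) ->
  `|\prod_(i <- s) x i - \prod_(i <- s) y i| <= \sum_(i <- s) `|x i - y i|.
Proof.
move=> x01 y01; elim: s => [|i s ih]; first by rewrite !big_nil subrr normr0.
have y1 : `|\prod_(i <- s) y i| <= 1.
  elim: s {ih} => [|j s ih]; first by rewrite big_nil normr1.
  rewrite big_cons normrM; have /andP[y0 y1] := y01 j.
  by rewrite ger0_norm// mulr_ile1.
rewrite !big_cons.
rewrite (_ : _ - _ = x i * (\prod_(i <- s) x i - \prod_(i <- s) y i) +
  (x i - y i) * \prod_(i <- s) y i); last by ring.
rewrite (le_trans (ler_normD _ _))// addrC !normrM lerD//.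
  by rewrite ler_piMr.
rewrite (le_trans _ ih)// ler_piMl//.
by have /andP[x0 x1] := x01 i; rewrite ger0_norm.
Qed.

Lemma cvg_prodr (I : Type) (s : seq I) (x : I -> nat -> R) (l : I -> R) :
  (forall i, x i k @[k --> \oo] --> l i) ->
  \prod_(i <- s) x i k @[k --> \oo] --> \prod_(i <- s) l i.
Proof.
move=> xl; elim: s => [|i s ih].
  by under eq_fun do rewrite big_nil; rewrite big_nil; exact: cvg_cst.
by under eq_fun do rewrite big_cons; rewrite big_cons; exact: cvgM.
Qed.

(** The product of averages over disjoint blocks has the desired mean for every [k]. Passing from
    each block to the negative indices costs at most [2 * 2 ^- k] per factor in mean, and bounded
    convergence yields the limit. The limits enter as arbitrary measurable versions [L], so that
    they may be modified on a null set. *)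
Lemma integral_prod_freq (s : seq int) (B : int -> set (borel K))
    (L : int -> borel (seqs K) -> R) :
  uniq s -> (forall i, measurable (B i)) ->
  (forall i, measurable_fun setT (L i)) ->
  (forall i, \forall w \ae mu,
    average R (B i) Negz (4 ^ k) w @[k --> \oo] --> L i w) ->
  \int[mu]_w (\prod_(i <- s) L i w) =
  fine (mu [set w | forall i, i \in s -> B i (coordinate i w)]).
Proof.
move=> us mB mL BL.
pose Q k w := \prod_(i <- s) average R (B i) Negz (4 ^ k) w.
pose P k w := \prod_(i <- s) average R (B i) (block i) (4 ^ k) w.
have bQ k : bounded_mfun (Q k).
  by apply: bounded_mfun_prod => i; exact: bounded_average.
have bP k : bounded_mfun (P k).
  by apply: bounded_mfun_prod => i; exact: bounded_average.
have PE k : \int[mu]_w P k w =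
    fine (mu [set w | forall i, i \in s -> B i (coordinate i w)]).
  have := @integral_prod_block_average s [::] (fun=> 0%N) B (4 ^ k)%N.
  rewrite expn_gt0 cats0 => /(_ isT us mB) <-.
  by apply: eq_Rintegral => w _; rewrite big_nil mulr1.
have QP k :
    `|\int[mu]_w P k w - \int[mu]_w Q k w| <= (size s)%:R * (2 * 2 ^- k).
  rewrite -RintegralB//; try exact: bounded_mfun_integrable.
  apply: (le_trans (le_normr_Rintegral _ _)) => //.
    by apply: bounded_mfun_integrable; exact: bounded_mfunB.
  have bD i : bounded_mfun (fun w => `|average R (B i) (block i) (4 ^ k) w -
      average R (B i) Negz (4 ^ k) w|).
    by apply: bounded_mfun_norm; apply: bounded_mfunB; exact: bounded_average.
  apply: (@le_trans _ _ (\int[mu]_w (\sum_(i <- s)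
      `|average R (B i) (block i) (4 ^ k) w -
        average R (B i) Negz (4 ^ k) w|))).
    apply: le_Rintegral_bounded.
    - by apply: bounded_mfun_norm; exact: bounded_mfunB.
    - exact: bounded_mfun_sum.
    - by move=> w; apply: prod_dist_le => i; exact: average_01.
  rewrite Rintegral_sum//.
  apply: (@le_trans _ _ (\sum_(i <- s) 2 * 2 ^- k)); last first.
    by rewrite big_const_seq count_predT iter_addr_0 -[leLHS]mulr_natl.
  apply: ler_sum => i _; apply: average_diff => //.
  - by move=> m n /block_inj[].
  - by move=> m n [].
have Qcvg : \int[mu]_w Q k w @[k --> \oo] -->
    fine (mu [set w | forall i, i \in s -> B i (coordinate i w)]).
  apply/cvgrPdist_le => /= e e0.
  have : (size s)%:R * 2 * 2 ^- k @[k --> \oo] --> (size s)%:R * 2 * (0 : R).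
    apply: cvgMr; under eq_fun do rewrite -exprVn.
    by apply: cvg_expr; rewrite ger0_norm ?invf_lt1// ltr1n.
  rewrite mulr0 => /cvgrPdist_le /(_ e e0); apply: filterS => k.
  rewrite sub0r normrN => h; rewrite -(PE k) (le_trans (QP k))//.
  by rewrite mulrA (le_trans (ler_norm _)).
apply/esym; apply: (cvg_unique _ Qcvg) => //.
apply: (@Rintegral_bounded_cvg _ _ _ _ Q _ 1).
- by move=> k; case: (bQ k).
- by apply: measurable_prod => i _; exact: mL.
- move=> k w; rewrite ger0_norm ?prodr_ge0//; last first.
    by move=> i _; have /andP[] := average_01 R (B i) Negz (4 ^ k) w.
  by apply: prodr_ile1 => i _; exact: average_01.
have : \forall w \ae mu, forall n,
    average R (B (odflt 0 (choice.unpickle n))) Negz (4 ^ k) w @[k --> \oo] -->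
    L (odflt 0 (choice.unpickle n)) w.
  by apply: ae_foralln => n; exact: BL.
apply: filterS => w h; apply: cvg_prodr => i.
by have := h (choice.pickle i); rewrite choice.pickleK.
Qed.

End frequencies.

(** * Extension from generating classes *)

Section dynkin.
Local Open Scope ereal_scope.
Context d (T : measurableType d) (R : realType) (G : set (set T)).
Hypotheses (TG : @measurable _ T = <<s G >>) (GI : setI_closed G).

Lemma measurable_evaluation d' (W : measurableType d')
    (nu : W -> probability T R) :
  (forall B, G B -> measurable_fun setT (fun w => nu w B)) ->
  forall B, measurable B -> measurable_fun setT (fun w => nu w B).
Proof.
move=> mG B; rewrite TG => sB.
apply: (@dynkin_induction _ _ G (fun B => measurable_fun setT (fun w => nu w B))
  TG GI _ _ _ _ _ sB) => //.
- apply: eq_measurable_fun (measurable_cst (1 : \bar R)) => w _.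
  by have /= -> := probability_setT (nu w).
- move=> S mS mnu.
  under eq_fun do rewrite probability_setC//.
  exact: emeasurable_funB.
- move=> F mF tF mnu.
  under eq_fun do rewrite measure_bigcup//.
  by apply: ge0_emeasurable_sum => // k _; exact: mnu.
Qed.

(** By monotone convergence the mixture is countably additive in [B], so agreement with [Q]
    propagates from a class closed under intersection. *)
Lemma mixture_unique d' (W : measurableType d') (P : probability W R)
    (nu : W -> probability T R) (Q : probability T R) :
  (forall B, G B -> measurable_fun setT (fun w => nu w B)) ->
  (forall B, G B -> \int[P]_w nu w B = Q B) ->
  forall B, measurable B -> \int[P]_w nu w B = Q B.
Proof.
move=> mG eG B mB; have mnu := measurable_evaluation mG.
move: (mB); rewrite TG => sB.
apply: (@dynkin_induction _ _ G (fun B => \int[P]_w nu w B = Q B) TG GI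
  _ _ _ _ _ sB) => //.
- under eq_integral do rewrite probability_setT.
  rewrite integral_cst// mul1e [RHS]probability_setT.
  exact: probability_setT.
- move=> S mS eS.
  under eq_integral do rewrite probability_setC//.
  rewrite integralB//; last 2 first.
  + exact: finite_measure_integrable_cst.
  + apply: (@le_integrable _ _ _ _ _ measurableT _ (cst 1)) => //.
    * exact: mnu.
    * by move=> w _; rewrite gee0_abs// abse1 probability_le1.
    * exact: finite_measure_integrable_cst.
  rewrite eS integral_cst// mul1e [RHS]probability_setC//; congr (_ - _).
  exact: probability_setT.
- move=> F mF tF eF.
  have mU : measurable (\bigcup_k F k) by exact: bigcupT_measurable.
  under eq_integral do rewrite measure_semi_bigcup//.
  rewrite integral_nneseries//; last by move=> n; exact: mnu.
  rewrite [RHS]measure_semi_bigcup//.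
  by apply: eq_eseriesr => n _; exact: eF.
Qed.

Lemma product_rule_extension d' (O : measurableType d') (P : probability O R)
    (Y : int -> O -> T) (pi : probability T R) :
  G setT -> (forall i, measurable_fun setT (Y i)) ->
  (forall (s : seq int) (A : int -> set T), uniq s -> (forall i, G (A i)) ->
    P [set w | forall i, i \in s -> A i (Y i w)] = \prod_(i <- s) pi (A i)) ->
  forall (s : seq int) (A : int -> set T), uniq s ->
    (forall i, measurable (A i)) ->
    P [set w | forall i, i \in s -> A i (Y i w)] = \prod_(i <- s) pi (A i).
Proof.
move=> GT mY hG.
have GM B : G B -> measurable B by rewrite TG => GB; exact: sub_sigma_algebra.
(* The sets are freed from [G] one index at a time: those at indices of [s1] are arbitrary, all
   others lie in [G]. With the remaining sets fixed, both sides are finite measures in the set at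
   [i]. *)
suff H (s1 s2 : seq int) (A : int -> set T) : uniq (s1 ++ s2) ->
    (forall i, measurable (A i)) -> (forall i, i \notin s1 -> G (A i)) ->
    P [set w | forall i, i \in s1 ++ s2 -> A i (Y i w)] =
    \prod_(i <- s1 ++ s2) pi (A i).
  move=> s A us mA; have := H s [::] (fun i => if i \in s then A i else setT).
  rewrite cats0 => /(_ us) h.
  rewrite (_ : [set w | _] = [set w | forall i, i \in s ->
      (if i \in s then A i else setT) (Y i w)]); last first.
    by apply/seteqP; split => w /= hA i si; have := hA i si; rewrite si.
  rewrite h.
  - by apply: eq_big_seq => i ->.
  - by move=> i; case: ifP.
  - by move=> i /negbTE ->.
elim: s1 s2 A => [|i s1 ih] s2 A us mA gA.
  by apply: hG => // i; exact: gA.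
pose D := [set w | forall k, k \in s1 ++ s2 -> A k (Y k w)].
have mPre B k : measurable B -> measurable (Y k @^-1` B).
  by move=> mB; rewrite -[X in measurable X]setTI; exact: mY.
have mD : measurable D.
  rewrite (_ : D = \bigcap_k (if k \in s1 ++ s2 then Y k @^-1` A k else setT)).
    by apply: bigcap_countType_measurable => k; case: ifP => // _; exact: mPre.
  apply/seteqP; split => w hw k; first by move=> _; case: ifP => //; exact: hw.
  by move=> ks; have := hw k Logic.I; rewrite ks.
set c := \prod_(k <- s1 ++ s2) pi (A k).
(* Finiteness of [c] makes the subtraction for complements legitimate in the extended reals. *)
have cE : c = (fine c)%:E.
  rewrite fineK// /c; elim: (s1 ++ s2) => [|k s ihs]; first by rewrite big_nil.
  by rewrite big_cons fin_numM// fin_num_measure.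
move: us => /=; rewrite mem_cat negb_or => /andP[/andP[is1 is2] us].
have keyG B' : G B' -> P (Y i @^-1` B' `&` D) = c * pi B'.
  move=> GB'.
  pose A' k := if k == i then B' else A k.
  have AE k : k \in s1 ++ s2 -> A' k = A k.
    rewrite /A'; case: eqP => // ->.
    by rewrite mem_cat (negbTE is1) (negbTE is2).
  have pE : perm_eq (s1 ++ i :: s2) (i :: s1 ++ s2).
    by rewrite -[i :: s2]cat1s perm_catCA.
  have us' : uniq (s1 ++ i :: s2).
    by rewrite (perm_uniq pE)/= mem_cat negb_or is1 is2.
  have := ih (i :: s2) A' us'.
  have A'i : A' i = B' by rewrite /A' eqxx.
  rewrite (perm_big _ pE) big_cons A'i.
  rewrite (_ : [set w | _] = Y i @^-1` B' `&` D); last first.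
    apply/seteqP; split => w /=.
      move=> hw; split.
        by have := hw i; rewrite /A' eqxx (perm_mem pE) mem_head; apply.
      move=> k ks; rewrite -AE//.
      by apply: hw; rewrite (perm_mem pE) inE ks orbT.
    move=> [h1 h2] k; rewrite (perm_mem pE) inE => /predU1P[->|ks].
      by rewrite /A' eqxx.
    by rewrite AE//; exact: h2.
  move=> ->.
  + rewrite muleC; congr (_ * _); apply: eq_big_seq => k ks; rewrite AE//.
  + by move=> k; rewrite /A'; case: ifP => // _; exact: GM.
  + move=> k ks1; rewrite /A'; case: eqP => // /eqP ki.
    by apply: gA; rewrite inE negb_or ki.
have PD : P D = c.
  have := keyG _ GT.
  by rewrite preimage_setT setTI [pi _]probability_setT mule1.
have key B : measurable B -> P (Y i @^-1` B `&` D) = c * pi B.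
  move=> mB; move: (mB); rewrite TG => sB.
  apply: (@dynkin_induction _ _ G (fun B => P (Y i @^-1` B `&` D) = c * pi B)
    TG GI _ _ _ _ _ sB) => //.
  - exact: keyG.
  - move=> S mS eS.
    rewrite (_ : _ `&` D = D `\` (Y i @^-1` S `&` D)); last first.
      apply/seteqP; split => w /=; first by move=> [h1 h2]; split => // -[].
      by move=> [h1 h2]; split => // h3; exact: h2.
    rewrite measureD//; last 2 first.
    + by apply: measurableI => //; exact: mPre.
    + by rewrite -ge0_fin_numE// fin_num_measure.
    rewrite setIidr; last by move=> w [].
    transitivity (c - c * pi S); first by congr (_ - _); [exact: PD|exact: eS].
    rewrite [pi (~` S)]probability_setC// cE -(fineK (fin_num_measure pi _ mS)).
    by rewrite -EFinM -!EFinB -EFinM mulrBr mulr1.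
  - move=> F mF tF eF.
    rewrite preimage_bigcup setI_bigcupl measure_semi_bigcup; last 3 first.
    + by move=> n; apply: measurableI => //; exact: mPre.
    + apply: trivIset_setIr => j k _ _ [w [Fj Fk]].
      by apply: tF => //; exists (Y i w).
    + by apply: bigcupT_measurable => n; apply: measurableI => //; exact: mPre.
    rewrite [pi _]measure_semi_bigcup//; last exact: bigcupT_measurable.
    rewrite cE -nneseriesZl//; apply: eq_eseriesr => n _.
    by rewrite -cE; exact: eF.
rewrite big_cons muleC -key//; congr (P _); apply/seteqP; split => w /=.
  move=> h; split; first by apply: h; rewrite mem_head.
  by move=> k ks; apply: h; rewrite inE ks orbT.
by move=> [h1 h2] k; rewrite inE => /predU1P[->//|]; exact: h2.
Qed.

End dynkin.

(* Replaces second countability of the target: near [theta w], the map [theta]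
   only depends on finitely many of the reals [a w j]. *)
Lemma measurable_of_modulus d (W : measurableType d) (R : realType)
    (T : ptopologicalType) (a : W -> nat -> R) (theta : W -> T) :
  (forall j, measurable_fun setT (a^~ j)) ->
  (forall w V, nbhs (theta w) V -> exists n, forall w',
     (forall j, (j < n)%N -> `|a w' j - a w j| < n.+1%:R^-1) -> V (theta w')) ->
  measurable_fun setT (theta : W -> borel T).
Proof.
move=> ma amod.
apply: (@measurability _ _ W (borel T) setT theta (@open T)) => //.
move=> _ [ O oO <-]; rewrite setTI.
(* Boxes with rational centres and half the radius of the modulus: two points of one box are within
   the full radius of each other, and there are only countably many boxes. *)
pose V (e : nat * seq rat) : set W := [set w | forall j, (j < e.1)%N ->
  `|a w j - ratr (nth 0 e.2 j)| < (2 * e.1.+1%:R)^-1].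
have mV e : measurable (V e).
  rewrite (_ : V e = \bigcap_j (if (j < e.1)%N then
      [set w | `|a w j - ratr (nth 0 e.2 j)| < (2 * e.1.+1%:R)^-1] else setT)).
    apply: bigcapT_measurable => j; case: ifP => // _.
    have : measurable_fun setT (fun w => `|a w j - ratr (nth 0 e.2 j)|).
      by apply: measurableT_comp => //; exact: measurable_funB.
    move=> /(_ measurableT `]-oo, (2 * e.1.+1%:R)^-1[%classic
      (measurable_itv _)).
    rewrite setTI; congr measurable; apply/seteqP; split => w /=;
      by rewrite in_itv.
  apply/seteqP; split => w h j; first by move=> _; case: ifP => // /h.
  by move=> je; have := h j Logic.I; rewrite je.
rewrite (_ : theta @^-1` O =
    \bigcup_(e in [set e | V e `<=` theta @^-1` O]) V e).
  exact: bigcup_countType_measurable.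
apply/seteqP; split => w; last by move=> [e /= eO /eO].
move=> wO; have [|n nO] := amod w O; first exact: open_nbhs_nbhs.
have e0 : 0 < (2 * n.+1%:R)^-1 :> R by rewrite invr_gt0 mulr_gt0.
have /choice[q qP] j : exists q, `|a w j - ratr q| < (2 * n.+1%:R)^-1.
  have [|q] := @rat_in_itvoo R (a w j - (2 * n.+1%:R)^-1)
    (a w j + (2 * n.+1%:R)^-1).
    by rewrite ltrD2l gtrN.
  rewrite in_itv/= => /andP[h1 h2]; exists q.
  by rewrite distrC ltr_distl h1.
exists (n, mkseq q n) => [w' hw'|j /= jn]; last by rewrite nth_mkseq.
apply: nO => j jn; have := hw' j jn; rewrite /= nth_mkseq// => h1.
have h2 := qP j.
rewrite (_ : _ - _ = (a w' j - ratr (q j)) - (a w j - ratr (q j))).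
  apply: le_lt_trans (ler_normB _ _) _.
  rewrite (_ : n.+1%:R^-1 = (2 * n.+1%:R)^-1 + (2 * n.+1%:R)^-1).
    exact: ltrD.
  by field; rewrite addrC natr1 pnatr_eq0.
by ring.
Qed.

(** * Integrals of continuous functions on the Cantor space *)

(** Compactness in its near-covering form: prefix lengths that work near each point yield one that
    works everywhere. *)
Lemma cantor_uniform_continuity (R : realType) (h : cantor_space -> R) :
  continuous h -> forall e : R, 0 < e -> exists m, forall b b',
    mkseq b m = mkseq b' m -> `|h b - h b'| < e.
Proof.
move=> ch e e0.
have cov := (compact_near_coveringP _).1 cantor_space_compact.
have [b _|m _ mP] := cov nat \oo (fun m b => forall b',
    mkseq b m = mkseq b' m -> `|h b - h b'| < e) _; last first.
  by exists m => b b'; apply: (mP m) => /=.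
have e2 : 0 < e / 2 by rewrite divr_gt0.
have /cvgrPdist_lt/(_ _ e2)/nbhs_cantorP[m mP] := ch b.
exists (cyl (mkseq b m), [set n | (m <= n)%N]).
  split => /=; first by apply/nbhs_cantorP; exists m.
  by exists m.
move=> [b1 n] [/= b1m mn] b2 b12.
have b2m : cyl (mkseq b m) b2.
  apply/cylP => i im; have /cylP/(_ i im) <- := b1m.
  have := congr1 (fun s => nth false s i) b12.
  by rewrite !nth_mkseq ?(leq_trans im mn).
have h1 := mP _ b1m; have h2 := mP _ b2m; rewrite /= in h1 h2.
rewrite (_ : _ - _ = (h b - h b2) - (h b - h b1)); last by ring.
by apply: le_lt_trans (ler_normB _ _) _; rewrite (splitr e) ltrD.
Qed.

(** These points represent the cylinders in Riemann sums; they also form a countable dense set. *)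
Definition pad (t : seq bool) : cantor_space := fun n => nth false t n.

Lemma mkseq_pad b m : mkseq (pad (mkseq b m)) m = mkseq b m.
Proof.
apply: (@eq_from_nth _ false); rewrite !size_mkseq// => i im.
by rewrite nth_mkseq.
Qed.

Section cantor_integral.
Variables (R : realType) (h : cantor_space -> R).
Hypothesis ch : continuous h.

Lemma bounded_cantor : bounded_mfun (h : borel cantor_space -> R).
Proof.
split; first exact: continuous_real_measurable.
have [m mP] := cantor_uniform_continuity ch (@ltr01 R).
exists (\sum_(t : m.-tuple bool) `|h (pad t)| + 1) => b.
have hb := mP b (pad (mkseq b m)) (esym (mkseq_pad b m)).
have : `|h (pad (mkseq b m))| <= \sum_(t : m.-tuple bool) `|h (pad t)|.
  rewrite (bigD1 [tuple of mkseq b m])//= lerDl.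
  by apply: sumr_ge0.
rewrite -[h b](subrK (h (pad (mkseq b m)))) => hm.
apply: (le_trans (ler_normD _ _)); rewrite addrC lerD// ltW//.
Qed.

Lemma integral_cantor_approx (beta : probability (borel cantor_space) R) m
    (e : R) :
  (forall b b', mkseq b m = mkseq b' m -> `|h b - h b'| < e) ->
  `|\int[beta]_b h b -
    \sum_(t : m.-tuple bool) h (pad t) * fine (beta (cyl t))| <= e.
Proof.
move=> mP; have bh := bounded_cantor.
have mcyl t : measurable (cyl t : set (borel cantor_space)).
  by apply: open_measurable_borel; exact: open_cyl.
pose g (b : borel cantor_space) : R :=
  \sum_(t : m.-tuple bool) h (pad t) * \1_(cyl t) b.
have bhi (t : m.-tuple bool) : bounded_mfun (fun b : borel cantor_space =>
    h (pad t) * \1_(cyl t) b).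
  by apply: bounded_mfunM; [exact: bounded_mfun_cst|exact: bounded_mfun_indic].
have bg : bounded_mfun g by exact: bounded_mfun_sum.
have <- : \int[beta]_b g b =
    \sum_(t : m.-tuple bool) h (pad t) * fine (beta (cyl t)).
  rewrite Rintegral_sum//; apply: eq_bigr => t _.
  by rewrite Rintegral_scale ?Rintegral_indic//; exact: bounded_mfun_indic.
have gE b : g b = h (pad (mkseq b m)).
  rewrite /g (bigD1 [tuple of mkseq b m])//= indicE mem_set ?mulr1; last first.
    by rewrite /cyl/= size_mkseq.
  rewrite big1 ?addr0// => t tb.
  rewrite indicE memNset ?mulr0//= /cyl/= size_tuple.
  by move=> bt; move/eqP : tb; apply; apply: val_inj.
rewrite -RintegralB//; try exact: bounded_mfun_integrable.
apply: (le_trans (le_normr_Rintegral _ _)) => //.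
  by apply: bounded_mfun_integrable; exact: bounded_mfunB.
apply: (@le_trans _ _ (\int[beta]_b e)).
  apply: le_Rintegral_bounded.
  - by apply: bounded_mfun_norm; exact: bounded_mfunB.
  - exact: bounded_mfun_cst.
  - by move=> b; rewrite gE ltW//; apply: mP; rewrite mkseq_pad.
by rewrite Rintegral_cst//; have /= -> := probability_setT beta; rewrite mulr1.
Qed.

End cantor_integral.

(** * The random Bernoulli measure *)

Section coding.
Variables (K : ptopologicalType) (c : cantor_space -> K).
Hypotheses (hK : hausdorff_space K) (cc : continuous c)
  (cs : forall x, exists b, c b = x).

(* Junk value: [decode m = (0, 0)] when [m] encodes no pair, so the bit [(0, 0)]
   occurs several times in [bits w]. *)
Definition decode (m : nat) : int * nat := odflt (0, 0%N) (choice.unpickle m).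

Definition bits (w : seqs K) : cantor_space :=
  fun m => code c (w (decode m).1) (decode m).2.

Definition unbits (b : cantor_space) : seqs K :=
  fun i => c (fun j => b (choice.pickle (i, j))).

Lemma bitsK w : unbits (bits w) = w.
Proof.
apply/funext => i; rewrite /unbits -[RHS](codeK hK cc cs).
by congr c; apply/funext => j; rewrite /bits /decode choice.pickleK.
Qed.

Definition section_bits (i : int) (b : cantor_space) : cantor_space :=
  fun j => b (choice.pickle (i, j)).

Lemma section_bits_continuous i : continuous (section_bits i).
Proof.
apply: ptws_continuous => j.
exact: (@proj_continuous _ (fun=> bool) (choice.pickle (i, j))).
Qed.

Lemma unbits_continuous : continuous unbits.
Proof.
apply: ptws_continuous => i b.
apply: (@continuous_comp _ _ _ (section_bits i) c); last exact: cc.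
exact: section_bits_continuous.
Qed.

Lemma measurable_unbits : measurable_fun [set: borel cantor_space]
  (unbits : borel cantor_space -> borel (seqs K)).
Proof. exact: continuous_measurable_borel unbits_continuous. Qed.

(* The constraints that [o] puts on the bits of the [i]-th coordinate. *)
Definition slice (o : seq (option bool)) (i : int) : set (borel K) :=
  [set x | forall m v, nth None o m = Some v -> (decode m).1 = i ->
     code c x (decode m).2 = v].

Lemma measurable_code_bit n v :
  measurable ([set x | code c x n = v] : set (borel K)).
Proof.
have := measurable_code hK cc measurableT (measurable_bit n v).
by rewrite setTI.
Qed.

Lemma measurable_slice o i : measurable (slice o i).
Proof.
rewrite (_ : slice o i = \bigcap_m (if nth None o m is Some v then
    if (decode m).1 == i then [set x | code c x (decode m).2 = v] else setT
  else setT : set (borel K))).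
  apply: bigcapT_measurable => m; case: nth => // v; case: ifP => // _.
  exact: measurable_code_bit.
apply/seteqP; split => x ox.
  by move=> m _; case h : nth => [v|] //=; case: eqP => // mi; exact: ox h mi.
by move=> m v h mi; have := ox m Logic.I; rewrite h mi eqxx.
Qed.

Lemma bits_matches o : bits @^-1` matches o =
  [set w | forall i, slice o i (coordinate i w)].
Proof.
apply/seteqP; split => w /= h; first by move=> i m v mv <-; exact: h.
by move=> m v mv; exact: (h (decode m).1).
Qed.

Definition support (o : seq (option bool)) : seq int :=
  undup [seq (decode m).1 | m <- iota 0 (size o)].

Lemma slice_support o i : i \notin support o -> slice o i = setT.
Proof.
rewrite mem_undup => ni; apply/seteqP; split => // x _ m v mv mi.
case/negP: ni; rewrite -mi; apply/mapP; exists m => //.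
by rewrite mem_iota/= add0n ltnNge; apply/negP => om; rewrite nth_default in mv.
Qed.

Lemma slice_Some o1 o2 v i : slice (o1 ++ Some v :: o2) i =
  if (decode (size o1)).1 == i then
    slice (o1 ++ None :: o2) i `&` [set x | code c x (decode (size o1)).2 = v]
  else slice (o1 ++ None :: o2) i.
Proof.
case: eqP => oi; apply/seteqP; split => x.
- move=> ox; split=> [m u mu|]; first by apply: ox; apply/nth_Some_cat; left.
  by apply: ox => //; apply/nth_Some_cat; right.
- by move=> [ox xv] m u /nth_Some_cat[|[-> ->]//]; exact: ox.
- by move=> ox m u mu; apply: ox; apply/nth_Some_cat; left.
- by move=> ox m u /nth_Some_cat[|[-> _] /oi//]; exact: ox.
Qed.

Variables (R : realType) (mu : law K R) (mu_exch : exchangeable mu).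

(** Only slices are asked to have frequencies. Patterns and coordinates are countably many, so the
    condition holds almost surely. *)
Definition regular (w : borel (seqs K)) := forall o i,
  cvgn (fun k => average R (slice o i) Negz (4 ^ k) w).

Lemma regular_cst (x : K) : regular (fun=> x).
Proof.
move=> o i; rewrite (_ : (fun k => _) = fun=> \1_(slice o i) x).
  exact: is_cvg_cst.
apply/funext => k; rewrite /average.
rewrite (eq_bigr (fun=> \1_(slice o i) x)) => [|m _]; last first.
  by rewrite /visits !indicE.
rewrite sumr_const card_ord -[X in _ * X]mulr_natl mulrA.
by rewrite mulVf ?mul1r// pnatr_eq0 -lt0n expn_gt0.
Qed.

Lemma regular_ae : \forall w \ae mu, regular w.
Proof.
pose f n : seq (option bool) * int := odflt ([::], 0) (choice.unpickle n).
have : \forall w \ae mu, forall n,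
    cvgn (fun k => average R (slice (f n).1 (f n).2) Negz (4 ^ k) w).
  apply: ae_foralln => n; apply: (average_ae_cvg mu_exch).
    exact: measurable_slice.
  by move=> i j [].
apply: filterS => w h o i.
by have := h (choice.pickle (o, i)); rewrite /f choice.pickleK.
Qed.

(** Irregular sequences lie in a measurable null set [N], all of which is sent to a constant
    sequence. This makes the later identities between frequencies valid at every [w]. *)
Lemma regular_retraction : exists r : borel (seqs K) -> borel (seqs K),
  [/\ measurable_fun setT r, forall w, regular (r w) &
      \forall w \ae mu, r w = w].
Proof.
have [N [mN N0 NP]] := regular_ae.
pose r w := if w \in N then (fun=> point : K) : borel (seqs K) else w.
exists r; split.
- apply: measurable_fun_ifT => //.
  apply: (measurable_fun_bool true); rewrite setTI.
  rewrite (_ : _ @^-1` _ = N)//.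
  by apply/seteqP; split => w /= => [/set_mem|/mem_set].
- move=> w; rewrite /r; case: ifPn => [_|wN]; first exact: regular_cst.
  by apply: contrapT => /NP/mem_set; rewrite (negbTE wN).
- exists N; split => // w /= h; apply: contrapT => wN; apply: h.
  by rewrite /r memNset.
Qed.

Variable r : borel (seqs K) -> borel (seqs K).
Hypotheses (mr : measurable_fun setT r) (r_regular : forall w, regular (r w))
  (r_id : \forall w \ae mu, r w = w).

Definition slice_freq o i (w : borel (seqs K)) : R := freq R (slice o i) (r w).

Lemma slice_freq_cvg o i w :
  average R (slice o i) Negz (4 ^ k) (r w) @[k --> \oo] --> slice_freq o i w.
Proof. exact: r_regular. Qed.

Lemma measurable_slice_freq o i : measurable_fun setT (slice_freq o i).
Proof.
apply: (measurable_fun_cvg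
  (h := fun k w => average R (slice o i) Negz (4 ^ k) (r w))).
  move=> k; apply: measurableT_comp => //.
  by case: (bounded_average R Negz (4 ^ k) (measurable_slice o i)).
by move=> w _; exact: slice_freq_cvg.
Qed.

Lemma slice_freq_01 o i w : 0 <= slice_freq o i w <= 1.
Proof.
have h := @slice_freq_cvg o i w; rewrite -(cvg_lim _ h)//.
have h01 k := average_01 R (slice o i) Negz (4 ^ k) (r w).
apply/andP; split.
  apply: limr_ge; first by apply/cvg_ex; eexists; exact: h.
  by apply: nearW => k; have /andP[] := h01 k.
apply: limr_le; first by apply/cvg_ex; eexists; exact: h.
by apply: nearW => k; have /andP[] := h01 k.
Qed.

Lemma slice_freq_setT o i w : slice o i = setT -> slice_freq o i w = 1.
Proof.
move=> oi; apply: (cvg_unique _ (@slice_freq_cvg o i w)) => //.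
rewrite (_ : (fun k => _) = fun=> 1); first exact: cvg_cst.
apply/funext => k; rewrite /average.
rewrite (eq_bigr (fun=> 1)) => [|m _].
  by rewrite sumr_const card_ord mulVf// pnatr_eq0 -lt0n expn_gt0.
by rewrite /visits indicE oi mem_set.
Qed.

Lemma slice_freqD o o1 o2 i w : slice o i = slice o1 i `|` slice o2 i ->
  slice o1 i `&` slice o2 i = set0 ->
  slice_freq o i w = slice_freq o1 i w + slice_freq o2 i w.
Proof.
move=> oU oI; apply: (cvg_unique _ (@slice_freq_cvg o i w)) => //.
rewrite (_ : (fun k => _) = fun k => average R (slice o1 i) Negz (4 ^ k) (r w) +
    average R (slice o2 i) Negz (4 ^ k) (r w)).
  by apply: cvgD; exact: slice_freq_cvg.
apply/funext => k; rewrite /average -mulrDr -big_split; congr (_ * _).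
apply: eq_bigr => m _; rewrite /visits oU !indicE.
rewrite (_ : [set w' | _] = [set w' | slice o1 i (coordinate (Negz m) w')] `|`
  [set w' | slice o2 i (coordinate (Negz m) w')])//.
rewrite in_setU; case: (boolP (_ \in _)) => [/set_mem/= h1|_];
  case: (boolP (_ \in _)) => [/set_mem/= h2|_]; rewrite /= ?addr0 ?add0r//.
have : (slice o1 i `&` slice o2 i) (coordinate (Negz m) (r w)) by [].
by rewrite oI.
Qed.

Definition match_prob (w : borel (seqs K)) o : R :=
  \prod_(i <- support o) slice_freq o i w.

(** An unconstrained coordinate contributes the factor 1, so any list covering the constrained
    coordinates gives the same product. *)
Lemma match_probE w o (s : seq int) : uniq s ->
  (forall i, i \notin s -> slice o i = setT) ->
  match_prob w o = \prod_(i <- s) slice_freq o i w.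
Proof.
move=> us hs.
have bigE (s1 s2 : seq int) : uniq s1 -> uniq s2 ->
    (forall i, i \notin s2 -> slice o i = setT) ->
    \prod_(i <- s1) slice_freq o i w =
    \prod_(i <- [seq i <- s1 | i \in s2]) slice_freq o i w.
  move=> u1 u2 h2; rewrite big_filter [RHS]big_mkcond/=.
  by apply: eq_bigr => i _; case: ifPn => // /h2; exact: slice_freq_setT.
have uo : uniq (support o) by exact: undup_uniq.
rewrite /match_prob (bigE _ s)// [RHS](bigE _ (support o))//; last first.
  exact: slice_support.
apply: perm_big; apply: uniq_perm; rewrite ?filter_uniq// => i.
by rewrite !mem_filter andbC.
Qed.

Lemma match_prob_ge0 w o : 0 <= match_prob w o.
Proof. by apply: prodr_ge0 => i _; have /andP[] := slice_freq_01 o i w. Qed.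

Lemma match_prob_nil w : match_prob w [::] = 1.
Proof. by rewrite /match_prob /support/= big_nil. Qed.

Lemma match_prob_rcons w o : match_prob w (rcons o None) = match_prob w o.
Proof.
have E i : slice (rcons o None) i = slice o i.
  apply/seteqP; split => x ox m v mv; apply: ox; move: mv; rewrite nth_rcons.
    by case: ltnP => // om; rewrite nth_default.
  by case: ltnP => // om; case: ifP.
rewrite [RHS](@match_probE _ _ (support (rcons o None))); last 2 first.
- exact: undup_uniq.
- by move=> i /slice_support; rewrite E.
by apply: eq_bigr => i _; rewrite /slice_freq E.
Qed.

(** Filling the entry at position [size o1] changes the slice of one coordinate only. That slice is
    partitioned by the two values of the bit, and the other factors are common to all three
    products. *)
Lemma match_prob_split w o1 o2 : match_prob w (o1 ++ None :: o2) =
  match_prob w (o1 ++ Some false :: o2) + match_prob w (o1 ++ Some true :: o2).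
Proof.
set s := support (o1 ++ None :: o2).
have us : uniq s by exact: undup_uniq.
(* [support] depends only on the length of the pattern, so a single [s] serves all three. *)
have sv v : match_prob w (o1 ++ Some v :: o2) =
    \prod_(i <- s) slice_freq (o1 ++ Some v :: o2) i w.
  by rewrite /match_prob /s /support !size_cat.
have h0 : (decode (size o1)).1 \in s.
  rewrite mem_undup; apply: map_f.
  by rewrite mem_iota/= add0n size_cat/= addnS ltnS leq_addr.
rewrite !sv /match_prob -/s !(bigD1_seq _ h0 us)/=.
have E v : \prod_(i <- s | i != (decode (size o1)).1)
      slice_freq (o1 ++ Some v :: o2) i w =
    \prod_(i <- s | i != (decode (size o1)).1)
      slice_freq (o1 ++ None :: o2) i w.
  by apply: eq_bigr => i io; rewrite /slice_freq slice_Some eq_sym (negbTE io).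
rewrite !E -mulrDl; congr (_ * _); apply: slice_freqD; rewrite !slice_Some eqxx.
  rewrite -setIUr; apply/seteqP; split => x; last by case.
  by move=> ox; split => //=; case: (code _ _ _); [right|left].
by apply/seteqP; split => // x [[_ /= ->] []].
Qed.

Lemma bits_law_exists (w : borel (seqs K)) :
  {beta : probability (borel cantor_space) R |
    forall o, beta (matches o) = (match_prob w o)%:E}.
Proof.
apply: cid; apply: matches_measure.
- exact: match_prob_ge0.
- exact: match_prob_nil.
- exact: match_prob_rcons.
- exact: match_prob_split.
Qed.

Definition bits_law w := sval (bits_law_exists w).

Lemma bits_lawE w o : bits_law w (matches o) = (match_prob w o)%:E.
Proof. exact: (svalP (bits_law_exists w)). Qed.

Lemma measurable_match_prob o : measurable_fun setT (match_prob^~ o).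
Proof. by apply: measurable_prod => i _; exact: measurable_slice_freq. Qed.

Lemma integral_match_prob o :
  (\int[mu]_w (match_prob w o)%:E)%E = mu (bits @^-1` matches o).
Proof.
have us : uniq (support o) by exact: undup_uniq.
have := @integral_prod_freq _ _ _ mu_exch (support o) (slice o) (slice_freq o)
  us (measurable_slice o) (measurable_slice_freq o).
rewrite (_ : [set w | _] = bits @^-1` matches o); last first.
  rewrite bits_matches; apply/seteqP; split => w /= h i; last by move=> _.
  have [/h//|/slice_support ->//] := boolP (i \in support o).
move=> h; rewrite -[RHS]fineK; last first.
  apply: fin_num_measure; rewrite bits_matches.
  rewrite (_ : [set w | _] = \bigcap_i [set w | slice o i (coordinate i w)]).
    apply: bigcap_countType_measurable => i.
    by apply: measurable_coordinate_preimage; exact: measurable_slice.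
  by apply/seteqP; split => w /= h' i; [move=> _; exact: h'|exact: (h' i)].
rewrite -h; last first.
  move=> i; apply: filterS r_id => w rw.
  by have := @slice_freq_cvg o i w; rewrite rw.
rewrite /Rintegral fineK//; apply: integrable_fin_num => //.
apply: bounded_mfun_integrable; split; first exact: measurable_match_prob.
exists 1 => w; rewrite ger0_norm ?match_prob_ge0//.
by apply: prodr_ile1 => i _; exact: slice_freq_01.
Qed.

Definition random_law (w : borel (seqs K)) : law K R :=
  distribution (bits_law w) (mfun_Sub (mem_set measurable_unbits)).

Lemma measurable_bits : measurable_fun setT
  (bits : borel (seqs K) -> borel cantor_space).
Proof.
apply: (measurable_generated borel_cantorE) => t.
rewrite -matches_map_Some bits_matches.
rewrite (_ : [set w | _] = \bigcap_i
    [set w | slice (map Some t) i (coordinate i w)]).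
  apply: bigcap_countType_measurable => i.
  by apply: measurable_coordinate_preimage; exact: measurable_slice.
by apply/seteqP; split => w /= h' i; [move=> _; exact: h'|exact: (h' i)].
Qed.

Lemma cylinder_bits_law B : cylinder_or_empty B ->
  measurable_fun setT (fun w => bits_law w B) /\
  (\int[mu]_w bits_law w B)%E = mu (bits @^-1` B).
Proof.
case=> [->|[t ->]].
  split; first by under eq_fun do rewrite measure0; exact: measurable_cst.
  under eq_integral do rewrite measure0.
  by rewrite integral0 preimage_set0 measure0.
rewrite -matches_map_Some -integral_match_prob; split.
  under eq_fun do rewrite bits_lawE.
  by apply/measurable_EFinP; exact: measurable_match_prob.
by apply: eq_integral => w _; rewrite bits_lawE.
Qed.

(** The identity is proved on bits, where cylinders determine a law: the mixture of the [bits_law w]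
    is the law [Q] of the coded sequence. Since [unbits] undoes [bits], the image of [Q] is [mu]. *)
Lemma integral_random_law (A : set (borel (seqs K))) : measurable A ->
  (\int[mu]_w random_law w A)%E = mu A.
Proof.
move=> mA; pose Q : probability (borel cantor_space) R :=
  distribution mu (mfun_Sub (mem_set measurable_bits)).
transitivity (Q (unbits @^-1` A)); last first.
  rewrite /Q /distribution/= /pushforward/=; congr (mu _).
  by apply/seteqP; split => w /=; rewrite bitsK.
transitivity (\int[mu]_w bits_law w (unbits @^-1` A))%E; first by [].
apply: (@mixture_unique _ (borel cantor_space) R cylinder_or_empty
  borel_cantor_cylinderE cylinder_setI_closed _ _ mu bits_law Q)
  => [B GB|B GB|].
- by have [] := cylinder_bits_law GB.
- by have [] := cylinder_bits_law GB.
- by rewrite -[X in measurable X]setTI; exact: measurable_unbits.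
Qed.

Lemma joint_constraints (s : seq int) (t : int -> seq bool) :
  exists o, forall m v, nth None o m = Some v <->
    exists i j, [/\ m = choice.pickle (i, j), i \in s
                  & nth None (map Some (t i)) j = Some v].
Proof.
pose N := (\max_(i <- s) \max_(j < size (t i)) (choice.pickle (i, val j)).+1)%N.
(* [pickle_inv] succeeds only at genuine codes of pairs, so the positions that [decode] maps to a
   junk pair stay free. *)
pose f m := if (choice.pickle_inv m : option (int * nat)) is Some ij then
  if ij.1 \in s then nth None (map Some (t ij.1)) ij.2 else None else None.
exists (mkseq f N) => m v; split.
  have [Nm|mN] := leqP N m; first by rewrite nth_default// size_mkseq.
  rewrite nth_mkseq// /f.
  have : oapp choice.pickle m (choice.pickle_inv m : option (int * nat)) = m.
    exact: choice.pickle_invK.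
  case: choice.pickle_inv => //= -[i j] /= ijm; case: ifP => // si tj.
  by exists i, j; rewrite ijm.
move=> [i [j [-> si tj]]].
have jt : (j < size (t i))%N.
  by rewrite ltnNge; apply/negP => h; rewrite nth_default ?size_map in tj.
rewrite nth_mkseq; first by rewrite /f choice.pickleK_inv/= si.
apply: leq_trans (leq_bigmax_seq _ si isT).
exact: (leq_bigmax_cond (Ordinal jt)).
Qed.

Lemma bits_law_cylinders w (s : seq int) (t : int -> seq bool) : uniq s ->
  bits_law w [set b | forall i, i \in s -> cyl (t i) (section_bits i b)] =
  (\prod_(i <- s) freq R (code c @^-1` cyl (t i)) (r w))%:E.
Proof.
move=> us; have [ o oP] := joint_constraints s t.
rewrite (_ : [set b | _] = matches o); last first.
  apply/seteqP; split => b hb.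
    move=> m v /oP[i [j [-> si tj]]].
    by have := hb i si; rewrite -matches_map_Some; apply.
  move=> i si; rewrite -matches_map_Some => j v tj.
  by apply: hb; apply/oP; exists i, j.
have slE i : slice o i = if i \in s then code c @^-1` cyl (t i) else setT.
  case: ifP => si; apply/seteqP; split => x // hx.
  - rewrite /preimage/= -matches_map_Some => j v tj.
    have := hx (choice.pickle (i, j)) v.
    rewrite /decode choice.pickleK/=; apply => //.
    by apply/oP; exists i, j.
  - move=> m v /oP[i' [j [-> si' tj]]]; rewrite /decode choice.pickleK/= => ii'.
    by move: hx; rewrite /preimage/= -matches_map_Some -ii'; apply.
  - move=> m v /oP[i' [j [-> si' tj]]]; rewrite /decode choice.pickleK/= => ii'.
    by rewrite -ii' si' in si.
rewrite bits_lawE (match_probE _ us); last first.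
  by move=> i /negbTE si; rewrite slE si.
by congr EFin; apply: eq_big_seq => i si; rewrite /slice_freq slE si.
Qed.

Lemma measurable_section_bits i : measurable_fun [set: borel cantor_space]
  (section_bits i : borel cantor_space -> borel cantor_space).
Proof. exact: continuous_measurable_borel (@section_bits_continuous i). Qed.

(** The frequency attached to a cylinder does not depend on the coordinate on which the cylinder is
    imposed; so the sections are independent and all distributed like the one at 0, at first on
    cylinders and then on Borel sets. *)
Lemma bits_law_product w (s : seq int) (A : int -> set (borel cantor_space)) :
  uniq s -> (forall i, measurable (A i)) ->
  bits_law w [set b | forall i, i \in s -> A i (section_bits i b)] =
  (\prod_(i <- s) bits_law w (section_bits 0 @^-1` A i))%E.
Proof.
move: s A.
apply: (@product_rule_extension _ (borel cantor_space) R cylinder_or_empty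
  borel_cantor_cylinderE cylinder_setI_closed _ _ (bits_law w) section_bits
  (distribution (bits_law w) (mfun_Sub (mem_set (measurable_section_bits 0))))).
- by right; exists [::]; apply/seteqP; split.
- exact: measurable_section_bits.
move=> s A us GA.
have piE t : bits_law w (section_bits 0 @^-1` cyl t) =
    (freq R (code c @^-1` cyl t) (r w))%:E.
  have := @bits_law_cylinders w [:: 0] (fun=> t) isT.
  rewrite big_seq1 => <-; congr (bits_law w _); apply/seteqP; split => b /=.
    by move=> h i; rewrite inE => /eqP ->.
  by apply; rewrite inE.
(* An empty side makes both members vanish; otherwise all relevant sides are cylinders. *)
have [[i si Ai0]|hA] := pselect (exists2 i, i \in s & A i = set0).
  rewrite (_ : [set b | _] = set0); last first.
    by apply/seteqP; split => // b /(_ i si); rewrite Ai0.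
  rewrite measure0; apply/esym/eqP; rewrite (bigD1_seq i)//= mule_eq0.
  by rewrite /distribution/= /pushforward Ai0 preimage_set0 measure0 eqxx.
have /choice[t tP] i : exists t, i \in s -> A i = cyl t.
  have [si|] := boolP (i \in s); last by exists [::].
  by case: (GA i) => [Ai0|[t ti]]; [case: hA; exists i|exists t].
rewrite (_ : [set b | _] =
    [set b | forall i, i \in s -> cyl (t i) (section_bits i b)]); last first.
  by apply/seteqP; split => b hb i si; have := hb i si; rewrite tP.
rewrite bits_law_cylinders// -prodEFin; apply: eq_big_seq => i si.
by rewrite tP//; exact/esym/piE.
Qed.

Lemma random_law_Ber w : Ber K R (random_law w).
Proof.
exists (distribution (random_law w)
  (mfun_Sub (mem_set (measurable_coordinate (K := K) 0)))) => F A mA.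
have mc : measurable_fun [set: borel cantor_space]
    (c : borel cantor_space -> borel K).
  exact: continuous_measurable_borel.
rewrite [LHS](_ : _ = bits_law w [set b | forall i, i \in enum_fset F ->
    (c @^-1` A i) (section_bits i b)]); last first.
  by congr (bits_law w _); apply/seteqP; split.
apply: (etrans (@bits_law_product w (enum_fset F) (fun i => c @^-1` A i)
  (fset_uniq F) _)) => //.
by move=> i; rewrite -[X in measurable X]setTI; exact: mc.
Qed.

(** Weak-star neighbourhoods test integrals of continuous functions only. Pulled back to bits, such
    an integral is approximated uniformly in the law by a Riemann sum over the words of some length
    [m], that is, by finitely many values of [match_prob]. *)
Lemma random_law_modulus w (V : set (weak_star (seqs K) R)) :
  nbhs (random_law w : weak_star (seqs K) R) V ->
  exists n, forall w', (forall j, (j < n)%N ->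
    `|match_prob w' (map Some (odflt [::] (choice.unpickle j))) -
      match_prob w (map Some (odflt [::] (choice.unpickle j)))| < n.+1%:R^-1) ->
    V (random_law w').
Proof.
pose close n w' := forall j, (j < n)%N ->
  `|match_prob w' (map Some (odflt [::] (choice.unpickle j))) -
    match_prob w (map Some (odflt [::] (choice.unpickle j)))| < n.+1%:R^-1.
have close_le m n w' : (m <= n)%N -> close n w' -> close m w'.
  move=> mn h j jm; apply: lt_le_trans (h j (leq_trans jm mn)) _.
  by rewrite lef_pV2 ?posrE// ler_nat ltnS.
pose F : set_system (weak_star (seqs K) R) :=
  filter_from [set: nat] (fun n => random_law @` [set w' | close n w']).
have FF : Filter F.
  apply: filter_from_filter; first by exists 0%N.
  move=> m n _ _; exists (maxn m n) => // _ [w' /= hw' <-].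
  split; exists w' => //.
    by apply: close_le hw'; exact: leq_maxl.
  by apply: close_le hw'; exact: leq_maxr.
suff Fw : F --> (random_law w : weak_star (seqs K) R).
  by move=> /Fw[n _ nV]; exists n => w' hw'; apply: nV; exists w'.
apply: (@initial_cvg _ _ (@integrals (seqs K) R)); apply: ptws_cvg => f.
pose h : cantor_space -> R := f \o unbits.
have ch : continuous h.
  move=> b; apply: (@continuous_comp _ _ _ unbits f).
    exact: unbits_continuous.
  exact: cts_fun.
have intE w' : integrals (random_law w') f = \int[bits_law w']_b h b.
  rewrite /integrals /Rintegral; congr fine.
  rewrite integral_distribution//.
    apply/measurable_EFinP.
    by apply: continuous_real_measurable; exact: cts_fun.
  have bh : bounded_mfun (h : borel cantor_space -> R) by exact: bounded_cantor.
  exact: (bounded_mfun_integrable (bits_law w') bh).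
apply/cvgrPdist_lt => e e0.
have e4 : 0 < e / 4 by rewrite divr_gt0.
have [m mP] := cantor_uniform_continuity ch e4.
pose M := \sum_(t : m.-tuple bool) `|h (pad t)|.
have M0 : 0 <= M by apply: sumr_ge0.
pose P := (\max_(t : m.-tuple bool) (choice.pickle (val t)).+1)%N.
(* Beyond [P] all words of length [m] have been enumerated; the other term keeps the weighted errors
   of their probabilities below [e / 4]. With the two approximation errors this makes less than
   [e]. *)
pose n := maxn P (Num.bound (M / (e / 4))).
have Mn : M * n.+1%:R^-1 < e / 4.
  rewrite ltr_pdivrMr// mulrC -ltr_pdivrMr//.
  apply: lt_le_trans (archi_boundP _) _; first by rewrite divr_ge0// ltW.
  by rewrite ler_nat ltnW// ltnS leq_maxr.
exists n => // _ [w' /= hw' <-]; rewrite !intE.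
have hp (t : m.-tuple bool) :
    `|fine (bits_law w (cyl t)) - fine (bits_law w' (cyl t))| <= n.+1%:R^-1.
  rewrite -matches_map_Some !bits_lawE/= distrC ltW//.
  have := hw' (choice.pickle (val t)); rewrite choice.pickleK; apply.
  by rewrite leq_max; apply/orP; left; exact: (leq_bigmax_cond t).
have h1 := integral_cantor_approx ch (bits_law w) mP.
have h2 := integral_cantor_approx ch (bits_law w') mP.
set S1 := \sum_(t : _) _ in h1; set S2 := \sum_(t : _) _ in h2.
have h3 : `|S1 - S2| <= M * n.+1%:R^-1.
  rewrite /S1 /S2 -sumrB /M mulr_suml; apply: (le_trans (ler_norm_sum _ _ _)).
  by apply: ler_sum => t _; rewrite -mulrBr normrM ler_wpM2l.
rewrite (_ : _ - _ = (\int[bits_law w]_b h b - S1) + (S1 - S2) -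
  (\int[bits_law w']_b h b - S2)); last by ring.
apply: le_lt_trans (ler_normB _ _) _.
have h4 := ler_normD (\int[bits_law w]_b h b - S1) (S1 - S2).
move: h1 h2 h3 h4 Mn e0.
move: (`|_|) (`|_|) (`|_|) (`|_|) (M * _) => x1 x2 x3 x4 y.
lra.
Qed.

Lemma measurable_random_law : measurable_fun setT
  (random_law : borel (seqs K) -> borel (weak_star (seqs K) R)).
Proof.
apply: (@measurable_of_modulus _ _ R (weak_star (seqs K) R)
  (fun w j => match_prob w (map Some (odflt [::] (choice.unpickle j))))).
  by move=> j; exact: measurable_match_prob.
exact: random_law_modulus.
Qed.

End coding.

(** * Measurability of the set of Bernoulli measures *)

Section cozero_base.
Variables (R : realType) (K : ptopologicalType) (d : K -> K -> R).
Hypothesis dK : compatible_metric d.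

Lemma compatible_metric_continuous y : continuous (d^~ y).
Proof.
have [d0 dC dD dN] := dK; move=> x; apply/cvgrPdist_lt => e e0.
apply/dN; exists e => // x' /= xx'; apply: le_lt_trans xx'.
rewrite ler_norml; apply/andP; split.
  by rewrite lerNl opprB lerBlDr (dC x x') dD.
by rewrite lerBlDr dD.
Qed.

(** Positive exactly on the ball of radius [e.2.+1%:R^-1] about a point of the countable dense image
    of the [pad] points. *)
Definition separator (c : cantor_space -> K) (e : seq bool * nat) (x : K) : R :=
  e.2.+1%:R^-1 - d x (c (pad e.1)).

Lemma separator_continuous c e : continuous (separator c e).
Proof.
by move=> x; apply: cvgB; [exact: cvg_cst|exact: compatible_metric_continuous].
Qed.

Lemma separator_base (c : cantor_space -> K) : continuous c ->
  (forall x, exists b, c b = x) -> forall x (V : set K), nbhs x V ->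
  exists2 e, 0 < separator c e x & [set y | 0 < separator c e y] `<=` V.
Proof.
have [d0 dC dD dN] := dK; move=> cc cs x V /dN[e e0 eV].
have e2 : 0 < e / 2 by rewrite divr_gt0.
have [n ne] := @ltr_add_invr R 0 (e / 2) e2; rewrite add0r in ne.
have [b bx] := cs x.
have /cc/nbhs_cantorP[m mP] : nbhs (c b) [set y | d (c b) y < n.+1%:R^-1].
  by apply/dN; exists n.+1%:R^-1.
have xb : d x (c (pad (mkseq b m))) < n.+1%:R^-1.
  by rewrite -bx; apply: mP; rewrite /cyl/= size_mkseq mkseq_pad.
exists (mkseq b m, n); first by rewrite subr_gt0.
move=> y /=; rewrite subr_gt0/= => yb; apply: eV => /=.
apply: le_lt_trans (dD _ (c (pad (mkseq b m))) _) _.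
by rewrite (splitr e) (dC _ y) ltrD// (lt_trans _ ne).
Qed.

End cozero_base.

(** * Rectangles with cozero sides and the equations that define Bernoulli measures *)

Section rect.
Variables (R : realType) (K : ptopologicalType) (I : countType).
Variable g : I -> K -> R.
Hypotheses (cg : forall e, continuous (g e))
  (gbase : forall x (V : set K), nbhs x V ->
    exists2 e, 0 < g e x & [set y | 0 < g e y] `<=` V).

(** Finite intersections make the class stable under intersection; the empty list gives the whole
    space. *)
Definition cozeros (l : seq I) : set K :=
  [set x | forall e, e \in l -> 0 < g e x].

Lemma cozeros_cons e l : cozeros (e :: l) = [set x | 0 < g e x] `&` cozeros l.
Proof.
apply/seteqP; split => x.
  move=> h; split; first by apply: h; rewrite mem_head.
  by move=> e' el; apply: h; rewrite inE el orbT.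
by move=> [h1 h2] e'; rewrite inE => /predU1P[->//|]; exact: h2.
Qed.

Lemma open_cozeros l : open (cozeros l).
Proof.
elim: l => [|e l ih].
  by rewrite (_ : cozeros _ = setT)//; [exact: openT|apply/seteqP; split].
rewrite cozeros_cons; apply: openI => //.
rewrite (_ : [set x | _] = g e @^-1` [set r | 0 < r])//.
by apply: open_comp; [move=> x _; exact: cg|exact: open_gt].
Qed.

Lemma cozeros_setI_closed : setI_closed (range cozeros).
Proof.
move=> _ _ [l1 _ <-] [l2 _ <-]; exists (l1 ++ l2) => //.
apply/seteqP; split => x.
  by move=> h; split => e el; apply: h; rewrite mem_cat el ?orbT.
by move=> [h1 h2] e; rewrite mem_cat => /orP[]; [exact: h1|exact: h2].
Qed.

Lemma borel_cozerosE : @measurable _ (borel K) = <<s range cozeros >>.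
Proof.
apply: borel_generated; first exact: open_cozeros.
move=> V x /gbase[e ex eV]; exists [:: e].
  by move=> e'; rewrite inE => /eqP ->.
by move=> y h; apply: eV; apply: h; rewrite inE.
Qed.

Definition rect (M : seq (int * I)) : set (seqs K) :=
  [set w | forall ie, ie \in M -> 0 < g ie.2 (coordinate ie.1 w)].

Lemma rect_cat M1 M2 : rect (M1 ++ M2) = rect M1 `&` rect M2.
Proof.
apply/seteqP; split => w.
  by move=> h; split => e el; apply: h; rewrite mem_cat el ?orbT.
by move=> [h1 h2] e; rewrite mem_cat => /orP[]; [exact: h1|exact: h2].
Qed.

Lemma open_rect M : open (rect M).
Proof.
elim: M => [|[i e] M ih].
  by rewrite (_ : rect _ = setT)//; [exact: openT|apply/seteqP; split].
rewrite -cat1s rect_cat; apply: openI => //.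
rewrite (_ : rect _ = (g e \o @coordinate K i) @^-1` [set r | 0 < r]).
  apply: open_comp; last exact: open_gt.
  move=> w _; apply: continuous_comp; first exact: coordinate_continuous.
  exact: cg.
apply/seteqP; split => w; first by move=> /(_ (i, e)); apply; rewrite inE.
by move=> h ie; rewrite inE => /eqP ->.
Qed.

Lemma rect_setI_closed : setI_closed (range rect).
Proof.
by move=> _ _ [M1 _ <-] [M2 _ <-]; exists (M1 ++ M2) => //; rewrite rect_cat.
Qed.

Lemma borel_rectE : @measurable _ (borel (seqs K)) = <<s range rect >>.
Proof.
apply: borel_generated; first exact: open_rect.
move=> V w wV; pose F := filter_from [set M | rect M w] rect.
have FF : Filter F.
  apply: filter_from_filter; first by exists [::].
  by move=> M1 M2 h1 h2; exists (M1 ++ M2); rewrite /= rect_cat.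
have Fw : F --> w.
  apply: ptws_cvg => i A /gbase[e ew eA]; exists [:: (i, e)].
    by move=> ie; rewrite inE => /eqP ->.
  by move=> w' h; apply: eA; apply: (h (i, e)); rewrite inE.
by have [M] := Fw V wV; exists M.
Qed.

(** Continuous functions with values in [[0, 1]] that tend pointwise to the indicator of [rect M];
    they tie [nu (rect M)] to the weak-star topology. *)
Definition bump (k : nat) (M : seq (int * I)) (w : seqs K) : R :=
  \prod_(ie <- M) Num.min 1 (k%:R * Num.max 0 (g ie.2 (coordinate ie.1 w))).

Lemma bump_continuous k M : continuous (bump k M).
Proof.
elim: M => [|ie M ih] w.
  rewrite /bump; under eq_fun do rewrite big_nil; exact: cvg_cst.
rewrite /bump; under eq_fun do rewrite big_cons; apply: cvgM; last exact: ih.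
apply: (@continuous_min R (seqs K) (fun=> 1)
  (fun w => k%:R * Num.max 0 (g ie.2 (coordinate ie.1 w)))).
  exact: cvg_cst.
apply: cvgM; first exact: cvg_cst.
apply: (@continuous_max R (seqs K) (fun=> 0)
  (fun w => g ie.2 (coordinate ie.1 w))).
  exact: cvg_cst.
apply: (@continuous_comp _ _ _ (@coordinate K ie.1) (g ie.2)).
  exact: coordinate_continuous.
exact: cg.
Qed.

Lemma bump_01 k M w : 0 <= bump k M w <= 1.
Proof.
have h (ie : int * I) :
    0 <= Num.min 1 (k%:R * Num.max 0 (g ie.2 (coordinate ie.1 w))) <= 1.
  by rewrite ge_min lexx/= andbT le_min ler01 mulr_ge0// le_max lexx.
by rewrite prodr_ile1 ?andbT// prodr_ge0// => ie _; have /andP[] := h ie.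
Qed.

Lemma bump_cvg M w : bump k M w @[k --> \oo] --> (\1_(rect M) w : R).
Proof.
have [wM|wM] := pselect (rect M w); last first.
  have [ie ieM gie] : exists2 ie, ie \in M & g ie.2 (coordinate ie.1 w) <= 0.
    apply: contrapT => h; apply: wM => ie ieM; rewrite ltNge; apply/negP => gie.
    by apply: h; exists ie.
  rewrite indicE memNset// (_ : (fun k => _) = fun=> 0); first exact: cvg_cst.
  apply/funext => k; rewrite /bump; apply/eqP; rewrite prodf_seq_eq0.
  by apply/hasP; exists ie => //=; rewrite max_l// mulr0 min_r.
rewrite indicE mem_set//.
(* From this [n] on, every factor is cut off at 1. *)
have [n nP] : exists n : nat, forall ie, ie \in M ->
    1 <= n%:R * g ie.2 (coordinate ie.1 w).
  elim: M wM => [|ie M ih] wM; first by exists 0%N.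
  have [|n nP] := ih; first by move=> ie' ieM; apply: wM; rewrite inE ieM orbT.
  have g0 : 0 < g ie.2 (coordinate ie.1 w) by apply: wM; rewrite mem_head.
  exists (maxn n (Num.bound (g ie.2 (coordinate ie.1 w))^-1)) => ie'.
  rewrite inE => /predU1P[->|ieM].
    rewrite -ler_pdivrMr// div1r ltW//.
    apply: lt_le_trans (archi_boundP _) _; first by rewrite invr_ge0 ltW.
    by rewrite ler_nat leq_maxr.
  apply: (le_trans (nP _ ieM)); rewrite ler_wpM2r ?ler_nat ?leq_maxl//.
  by rewrite ltW//; apply: wM; rewrite inE ieM orbT.
apply: cvg_near_cst; exists n => // k /= nk; rewrite /bump.
rewrite big_seq big1// => ie ieM; have g0 := wM _ ieM.
rewrite max_r ?ltW// min_l// (le_trans (nP _ ieM))//.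
by rewrite ler_wpM2r ?ler_nat// ltW.
Qed.

Lemma integral_bump_cvg (nu : law K R) M :
  \int[nu]_w bump k M w @[k --> \oo] --> fine (nu (rect M)).
Proof.
have mM : measurable (rect M : set (borel (seqs K))).
  by apply: open_measurable_borel; exact: open_rect.
rewrite -Rintegral_indic//; apply: (@Rintegral_bounded_cvg _ _ _ _ _ _ 1).
- by move=> k; apply: continuous_real_measurable; exact: bump_continuous.
- exact: measurable_indic.
- by move=> k w; have /andP[h1 h2] := bump_01 k M w; rewrite ger0_norm.
- by apply: aeW => w; exact: bump_cvg.
Qed.

Lemma weak_star_integral_continuous (T : ptopologicalType) (f : T -> R) :
  continuous f ->
  continuous
    (fun nu : weak_star T R => \int[nu : probability (borel T) R]_w f w).
Proof.
move=> cf.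
pose F : continuousType T R := HB.pack f (isContinuous.Build T R f cf).
move=> nu.
apply: (@continuous_comp _ _ _ (@integrals T R : weak_star T R -> _)
  (fun h => h F)).
  exact: initial_continuous.
exact: (@proj_continuous _ (fun=> R) F).
Qed.

Lemma measurable_weak_star_rect M : measurable_fun
  [set: borel (weak_star (seqs K) R)] (fun nu => (nu : law K R) (rect M)).
Proof.
rewrite (_ : (fun nu => _) = (fun nu => (fine ((nu : law K R) (rect M)))%:E)).
  apply/measurable_EFinP.
  apply: (@measurable_fun_cvg _ (borel (weak_star (seqs K) R)) R setT
    (fun k (nu : borel (weak_star (seqs K) R)) =>
      \int[nu : law K R]_w bump k M w)
    (fun nu => fine ((nu : law K R) (rect M)))) => [k|nu _];
    last exact: integral_bump_cvg.
  apply: continuous_real_measurable; apply: weak_star_integral_continuous.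
  exact: bump_continuous.
apply/funext => nu; rewrite fineK//; apply: fin_num_measure.
by apply: open_measurable_borel; exact: open_rect.
Qed.

Lemma measurable_weak_star_evaluation (A : set (borel (seqs K))) :
  measurable A -> measurable_fun
    [set: borel (weak_star (seqs K) R)] (fun nu => (nu : law K R) A).
Proof.
apply: (@measurable_evaluation _ (borel (seqs K)) R (range rect) borel_rectE
  rect_setI_closed _ (borel (weak_star (seqs K) R)) (fun nu => nu : law K R)).
by move=> _ [M _ <-]; exact: measurable_weak_star_rect.
Qed.

(** The sides are lists read by position in [s], which keeps the data in a countable type; a missing
    side defaults to [[::]], the whole space. *)
Definition cozero_rect (s : seq int) (L : seq (seq I)) : set (seqs K) :=
  [set w | forall i, i \in s ->
     cozeros (nth [::] L (index i s)) (coordinate i w)].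

Definition cozero_slab (l : seq I) : set (seqs K) :=
  [set w | cozeros l (coordinate 0 w)].

Lemma measurable_cozeros l : measurable (cozeros l : set (borel K)).
Proof. by apply: open_measurable_borel; exact: open_cozeros. Qed.

Lemma measurable_cozero_rect s L :
  measurable (cozero_rect s L : set (borel (seqs K))).
Proof.
apply: (@measurable_rectangle K int (fun i => i \in s) id
  (fun i => cozeros (nth [::] L (index i s)))) => i.
exact: measurable_cozeros.
Qed.

Lemma product_law_seq (pi : probability (borel K) R) (nu : law K R)
    (s : seq int) (A : int -> set (borel K)) :
  product_law pi nu -> uniq s -> (forall i, measurable (A i)) ->
  nu [set w | forall i, i \in s -> A i (coordinate i w)] =
  (\prod_(i <- s) pi (A i))%E.
Proof.
move=> pinu us mA; pose F := [fset i in s]%fset.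
have sF i : (i \in F) = (i \in s) by rewrite in_fset.
rewrite [LHS](_ : _ = nu [set w | forall i, i \in F -> A i (coordinate i w)]).
  rewrite pinu//; apply: perm_big; apply: uniq_perm => // i; exact: sF.
by congr (nu _); apply/seteqP; split => w h i si; apply: h; rewrite ?sF// -sF.
Qed.

(** The base law must be the marginal at coordinate 0, which removes the existential quantifier over
    [pi]. The product rule for cozero sides then extends to all Borel sides. *)
Lemma Ber_cozeroP (nu : law K R) : Ber K R nu <->
  forall s L, uniq s -> nu (cozero_rect s L) =
    (\prod_(i <- s) nu (cozero_slab (nth [::] L (index i s))))%E.
Proof.
split=> [[pi pinu] s L us|h].
  have slabE l : nu (cozero_slab l) = pi (cozeros l).
    have := product_law_seq pinu (s := [:: 0]) isT
      (fun=> measurable_cozeros l : measurable (cozeros l : set (borel K))).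
    rewrite big_seq1 => <-; congr (nu _); apply/seteqP; split => w /=.
      by move=> hw i; rewrite inE => /eqP ->.
    by apply; rewrite inE.
  rewrite (product_law_seq pinu us (fun i => measurable_cozeros _)).
  by apply: eq_bigr => i _; rewrite slabE.
exists (distribution nu
  (mfun_Sub (mem_set (measurable_coordinate (K := K) 0)))).
move=> F A mA; apply: (@product_rule_extension _ (borel K) R (range cozeros)
  borel_cozerosE cozeros_setI_closed _ (borel (seqs K)) nu
  (fun i => @coordinate K i)) => //.
- by exists [::] => //; apply/seteqP; split.
- exact: measurable_coordinate.
- move=> s B us hB.
  have /choice[l lB] i : exists l, cozeros l = B i.
    by have [l _ <-] := hB i; exists l.
  have sl i : i \in s -> nth [::] (map l s) (index i s) = l i.
    by move=> si; rewrite (nth_map 0) ?index_mem// nth_index.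
  have := h s (map l s) us.
  rewrite (_ : cozero_rect _ _ =
      [set w | forall i, i \in s -> B i (coordinate i w)]).
    move=> ->; apply: eq_big_seq => i si.
    by rewrite sl// /distribution/= /pushforward/= -lB.
  by apply/seteqP; split => w hw i si; have := hw i si; rewrite sl// lB.
- exact: fset_uniq.
Qed.

Lemma measurable_Ber :
  measurable (Ber K R : set (borel (weak_star (seqs K) R))).
Proof.
pose f (A : set (borel (seqs K))) (nu : borel (weak_star (seqs K) R)) : R :=
  fine ((nu : law K R) A).
have mf A : measurable A -> measurable_fun setT (f A).
  move=> mA; apply/measurable_EFinP.
  apply: eq_measurable_fun (measurable_weak_star_evaluation mA) => nu _ /=.
  by rewrite fineK//; exact: fin_num_measure.
(* A list with repeated indices imposes no condition. *)
pose E (e : seq int * seq (seq I)) : set (borel (weak_star (seqs K) R)) :=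
  if uniq e.1 then
    [set nu | f (cozero_rect e.1 e.2) nu -
      \prod_(i <- e.1) f (cozero_slab (nth [::] e.2 (index i e.1))) nu = 0]
  else setT.
have mslab l : measurable (cozero_slab l : set (borel (seqs K))).
  by apply: measurable_coordinate_preimage; exact: measurable_cozeros.
rewrite (_ : Ber K R = \bigcap_e E e).
  apply: bigcap_countType_measurable => -[s L]; rewrite /E/=; case: ifP => // _.
  have : measurable_fun setT (fun nu => f (cozero_rect s L) nu -
      \prod_(i <- s) f (cozero_slab (nth [::] L (index i s))) nu).
    apply: measurable_funB; first by apply: mf; exact: measurable_cozero_rect.
    by apply: measurable_prod => i _; exact: mf.
  by move=> /(_ measurableT [set 0] (measurable_set1 _)); rewrite setTI.
have key (nu : law K R) s L : nu (cozero_rect s L) =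
    (\prod_(i <- s) nu (cozero_slab (nth [::] L (index i s))))%E <->
    f (cozero_rect s L) nu -
      \prod_(i <- s) f (cozero_slab (nth [::] L (index i s))) nu = 0.
  have fE A : measurable A -> nu A = (f A nu)%:E.
    by move=> mA; rewrite /f fineK//; exact: fin_num_measure.
  rewrite fE; last exact: measurable_cozero_rect.
  rewrite (eq_bigr (fun i => (f (cozero_slab (nth [::] L (index i s))) nu)%:E));
    last by move=> i _; rewrite fE.
  rewrite prodEFin; split; first by move=> [->]; rewrite subrr.
  by move=> /subr0_eq ->.
apply/seteqP; split => nu.
  move=> /Ber_cozeroP h -[s L] _; rewrite /E/=; case: ifP => // us.
  by apply/key; exact: h.
move=> h; apply/Ber_cozeroP => s L us; have := h (s, L) Logic.I.
by rewrite /E/= us => /key.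
Qed.

End rect.

(** * The mixing measure as the image of the law under the random product measure *)

Theorem corollary2 (R : realType) (K : ptopologicalType)
    (K_compact : compact [set: K]) (K_metrizable : metrizable R K)
    (mu : law K R) (mu_exch : exchangeable mu) :
  exists eta : probability (borel (weak_star (seqs K) R)) R,
    [/\ measurable (Ber K R : set (borel (weak_star (seqs K) R))),
        eta (Ber K R) = 1%E,
        forall A : set (borel (seqs K)), measurable A ->
          mu A = (\int[eta]_(nu in Ber K R) (nu : law K R) A)%E
      & forall (k : nat) (A : 'I_k -> set (borel K)),
          (1 <= k)%N -> (forall i, measurable (A i)) ->
          mu [set w | forall i : 'I_k, A i (coordinate (i.+1)%:Z w)] =
            (\int[eta]_(nu in Ber K R)
               \prod_(i < k) base_law (nu : law K R) (A i))%E].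
Proof.
have [d dK] := K_metrizable.
have hK := compatible_metric_hausdorff dK.
have [c cc cs] := compact_metrizable_cantor_surj dK K_compact.
have [r [mr r_regular r_id]] := regular_retraction hK cc mu_exch.
pose nu : borel (seqs K) -> borel (weak_star (seqs K) R) :=
  random_law cc r_regular.
have mnu : measurable_fun setT nu by exact: measurable_random_law.
pose eta : probability (borel (weak_star (seqs K) R)) R :=
  distribution mu (mfun_Sub (mem_set mnu)).
have mBer : measurable (Ber K R : set (borel (weak_star (seqs K) R))).
  apply: (measurable_Ber (g := separator d c)) => [e|x V].
    exact: separator_continuous.
  exact: separator_base.
have mev A : measurable A -> measurable_fun
    [set: borel (weak_star (seqs K) R)] (fun nu => (nu : law K R) A).
  apply: (measurable_weak_star_evaluation (g := separator d c)) => [e|x V].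
    exact: separator_continuous.
  exact: separator_base.
have etaBer : eta (Ber K R) = 1%E.
  rewrite /eta/= /distribution /pushforward/= (_ : nu @^-1` _ = setT).
    exact: probability_setT.
  by apply/seteqP; split => w // _; exact: random_law_Ber.
have muE (A : set (borel (seqs K))) : measurable A ->
    mu A = (\int[eta]_(nu in Ber K R) (nu : law K R) A)%E.
  move=> mA.
  rewrite -(integral_random_law hK cc cs mu_exch mr r_regular r_id mA).
  transitivity (\int[eta]_nu (nu : law K R) A)%E.
    rewrite ge0_integral_distribution//; exact: mev.
  (* The complement of [Ber] is [eta]-null, so restricting the domain of integration leaves the
     integral unchanged. *)
  rewrite (@ge0_negligible_integral _ _ _ eta setT (~` Ber K R))//.
  - by rewrite setTD setCK.
  - exact: measurableC.
  - exact: mev.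
  - transitivity (1 - eta (Ber K R))%E; first exact: probability_setC.
    by rewrite etaBer subee.
exists eta; split => // k A k1 mA.
pose s : seq int := [seq (i.+1)%:Z | i : 'I_k <- enum 'I_k].
(* The sides are extended to all integer indices by the whole space; the shift by one places [A i]
   at index [i.+1], as the coordinates are counted from 1. *)
pose B (n : int) : set (borel K) :=
  if [pick i : 'I_k | (i.+1)%:Z == n] is Some i then A i else setT.
have BE (i : 'I_k) : B (i.+1)%:Z = A i.
  rewrite /B; case: pickP => [j /eqP[] /val_inj -> //|/(_ i)].
  by rewrite eqxx.
have mB n : measurable (B n) by rewrite /B; case: pickP.
have us : uniq s.
  by rewrite map_inj_uniq ?enum_uniq// => i j [] /val_inj.
rewrite (_ : [set w | _] = [set w | forall n, n \in s -> B n (coordinate n w)]).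
  rewrite muE; last first.
    exact: (@measurable_rectangle K int (fun n => n \in s) id B).
  apply: eq_integral => lam /set_mem lamBer.
  (* On [Ber] the value chosen by [get] really is a base law, so the product rule applies to it. *)
  have blam : product_law (base_law lam) lam.
    by rewrite /base_law; apply: (@getPex _ [set p | product_law p lam]).
  rewrite (product_law_seq blam us mB) big_map big_enum/=.
  by apply: eq_bigr => i _; rewrite BE.
apply/seteqP; split => w h.
  by move=> n /mapP[i _ ->]; rewrite BE; exact: h.
by move=> i; rewrite -BE; apply: h; apply: map_f; rewrite mem_enum.
Qed.
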